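(* Let $G$ and $G'$ be simple graphs with the same number of vertices, $n_G=n_{G'}$. Then the following are equivalent: (1) $\zeta_G^{\uparrow\uparrow}=\zeta_{G'}^{\uparrow\uparrow}$ (equality of outgoing zeta functions); (2) $\mu_G=\mu_{G'}$ (equality of lazy-deadly Markov chain functions); (3) for some $c\in\mathbb{C}$, $\mu_G(x,a,c)=\mu_{G'}(x,a,c)$ as functions of the two variables $x$ and $a$; (4) $\overset{\rightleftharpoons}{\eta}_G=\overset{\rightleftharpoons}{\eta}_{G'}$; (5) $\overset{\rightleftharpoons}{\eta}_{S\succeq G}=\overset{\rightleftharpoons}{\eta}_{S\succeq G'}$ for every symmetric invader $S$; (6) $\chi_{S\succeq G}=\chi_{S\succeq G'}$ for every symmetric invader $S$; (7) $\chi_{S\succeq G}=\chi_{S\succeq G'}$ for every undirected path $S$ whose endpoints are its native vertices; (8) $\chi_{S\succeq G}=\chi_{S\succeq G'}$ for every two-vertex invader $S$ with $A_S=\begin{pmatrix}k&1\\1&k\end{pmatrix}\in\mathbb{Z}_{>0}^{2\times2}$; (9) $\chi_{S\succeq G}=\chi_{S\succeq G'}$ for every two-vertex invader $S$ with $A_S=\begin{pmatrix}1&k\\k&1\end{pmatrix}\in\mathbb{Z}_{>0}^{2\times2}$.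
   Context: Digraphs are finite. In general, an (unweighted) digraph may have loops and parallel edges. For a digraph $H$, $n_H$ is the number of vertices, $A_H\in\mathbb{Z}_{\ge 0}^{n_H\times n_H}$ is the adjacency matrix ($[A_H]_{ij}$ is the number of edges from $i$ to $j$), and $D_H^{\mathrm{out}}$ is the diagonal matrix of row sums of $A_H$. A graph is a digraph $H$ with $A_H^T=A_H$; then $D_H=D_H^{\mathrm{out}}$ is its degree matrix. A simple graph has no loops and no parallel edges; each undirected edge $\{v,v'\}$ is the pair of directed edges $(v,v'),(v',v)$. Characteristic polynomials: $\chi_H(x)=\det(xI_{n_H}-A_H)$ and $\overset{\rightleftharpoons}{\eta}_H(x,t,u)=\det(xI_{n_H}+tD_H^{\mathrm{out}}+uA_H)$; for a graph $H$ this is $\det(xI_{n_H}+tD_H+uA_H)$. Markov chain function of a graph $G$: $$\mu_G(x,a,b)=\det\Big(xI_{n_G}+\big((a+b)I_{n_G}+D_G\big)^{-1}\big(A_G+aI_{n_G}\big)\Big),$$ regarded as a polynomial in $x$ whose coefficients are rational functions of $a,b$ (so that $b=c$ may be substituted for any $c\in\mathbb{C}$). Outgoing zeta function of a simple graph $G$: A circuit in $G$ is a sequence of directed edges $\gamma=(e_1,\dots,e_\ell)$, $\ell\ge1$, such that the head of $e_i$ is the tail of $e_{i+1}$ for all $i$, with $e_{\ell+1}=e_1$; put $|\gamma|=\ell$. A cycle $[\gamma]$ is an equivalence class of circuits under cyclic permutation of edges; it is primitive if none of its representatives is a $k$-fold concatenation of a circuit with itself for some $k\ge2$. Let $b(\gamma)$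 be the number of $i\in\{1,\dots,\ell\}$ such that $e_{i+1}$ is the reverse of $e_i$ (indices cyclic). With $\mathcal{P}_G$ the set of primitive cycles in $G$, $$\zeta_G^{\uparrow\uparrow}(t,u)=\prod_{[\gamma]\in\mathcal{P}_G}\frac{1}{1-t^{\,b(\gamma)}u^{|\gamma|}},$$ for sufficiently small $|t|,|u|$. Invasions: An invader is a digraph $S$ (loops and parallel edges allowed) with $n_S\ge2$ vertices, listed in order; the first vertex and the last vertex are called native. $S$ is symmetric if it has an automorphism that interchanges its two native vertices. If $G$ is a graph without loops and $S$ is symmetric, the symmetrically invaded digraph $S\succeq G$ is obtained by replacing each undirected edge $\{(v,v'),(v',v)\}$ of $G$ with one copy of $S$, where $v$ and $v'$ are identified with the first and the last vertex of that copy, respectively (all other vertices of the copies are new and distinct); this is well defined up to isomorphism. *)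

(* Defs.v *)
(* The complex numbers are R[i] with R : realType. *)
From mathcomp Require Import all_boot all_order perm all_algebra.
From mathcomp Require Import complex.
From mathcomp Require Import boolp classical_sets topology normedtype sequences.

Set Implicit Arguments.
Unset Strict Implicit.
Unset Printing Implicit Defensive.

Import Order.TTheory GRing.Theory Num.Theory.
Import numFieldNormedType.Exports.

Local Open Scope ring_scope.

(* A digraph on the vertices 0, ..., n-1, loops and parallel edges allowed,
   is given by its adjacency matrix: [H i j] is the number of edges from i
   to j. *)
Notation digraph n := 'M[nat]_n.

Definition is_graph n (H : digraph n) : Prop := H^T = H.

Definition is_simple_graph n (H : digraph n) : Prop :=
  [/\ is_graph H, forall i, H i i = 0%N & forall i j, (H i j <= 1)%N].

Definition adjmx (R : nzRingType) n (H : digraph n) : 'M[R]_n :=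
  map_mx (fun m : nat => m%:R) H.

Definition outdegmx (R : nzRingType) n (H : digraph n) : 'M[R]_n :=
  diag_mx (\row_i (\sum_j H i j)%N%:R).

Definition chi n (H : digraph n) : {poly int} := char_poly (adjmx int H).

Definition eta_at (R : comNzRingType) n (H : digraph n) (x t u : R) : R :=
  \det (x%:M + t *: outdegmx R H + u *: adjmx R H).

(* A polynomial in three variables: x, t and u are, in this order, the
   variables of the outermost, middle and innermost polynomial rings. *)
Definition eta n (H : digraph n) : {poly {poly {poly int}}} :=
  eta_at H 'X 'X%:P 'X%:P%:P.

(* The Markov chain function as a polynomial in x, with the parameters a and b
   taken in an arbitrary field F. *)
Definition mu_at (F : fieldType) n (G : digraph n) (a b : F) : {poly F} :=
  \det ('X%:M + map_mx polyC
     (invmx ((a + b)%:M + outdegmx F G) *m (adjmx F G + a%:M))).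

(* Here F is the field C(a, b) of rational functions. *)
Definition mu (C : fieldType) n (G : digraph n) :
    {poly {fraction {poly {poly C}}}} :=
  mu_at G (FracField.tofrac 'X) (FracField.tofrac 'X%:P).

(* The substitution b = c in [mu]: now F is C(a).  The matrix
   (a + c) I + D is diagonal with entries a + c + d_v <> 0 in C(a), so it is
   still invertible. *)
Definition mu_spec (C : fieldType) n (G : digraph n) (c : C) :
    {poly {fraction {poly C}}} :=
  mu_at G (FracField.tofrac 'X) (FracField.tofrac c%:P).

Section Zeta.
Variables (n : nat) (G : digraph n).

(* In a simple graph a directed edge is determined by the pair (tail, head). *)
Let dart := ('I_n * 'I_n)%type.

Definition is_circuit (c : seq dart) : bool :=
  [&& c != [::], all (fun e => (0 < G e.1 e.2)%N) c
    & cycle (fun e f => e.2 == f.1) c].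

Definition is_primitive (c : seq dart) : Prop :=
  forall (i k : nat) (d : seq dart),
    (2 <= k)%N -> is_circuit d -> rot i c <> flatten (nseq k d).

Definition backtracks (c : seq dart) : nat :=
  count (fun p : dart * dart => p.2 == (p.1.2, p.1.1)) (zip c (rot 1 c)).

Definition primitive_circuits (l : nat) : {set l.-tuple dart} :=
  [set c : l.-tuple dart | is_circuit c && `[< is_primitive c >]].

Definition rotation_rel (l : nat) : rel (l.-tuple dart) :=
  fun c d => [exists i : 'I_l.+1, tval d == rot i c].

Definition primitive_cycles (l : nat) : {set {set l.-tuple dart}} :=
  equivalence_partition (@rotation_rel l) (primitive_circuits l).

Variables (C : numFieldType) (t u : C).

(* [transversal] selects one representative circuit in each cycle; the factor
   does not depend on this choice. *)
Definition zeta_upto (N : nat) : C :=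
  \prod_(1 <= l < N.+1)
    \prod_(c in transversal (primitive_cycles l) (primitive_circuits l))
      (1 - t ^+ backtracks c * u ^+ l)^-1.

(* There are finitely many cycles of each length and the infinite product
   converges absolutely for small t and u, so its factors may be grouped by
   length; the value is unspecified where the limit does not exist. *)
Definition zeta : C := lim (zeta_upto @ \oo)%classic.

End Zeta.

(* zeta is only defined near t = u = 0. *)
Definition zeta_eq (C : numFieldType) n (G G' : digraph n) : Prop :=
  exists2 r : C, 0 < r &
    forall t u : C, `|t| < r -> `|u| < r -> zeta G t u = zeta G' t u.

(* An invader on k + 2 vertices is a [digraph k.+2]; its native vertices are
   [ord0] and [ord_max]. *)
Definition symmetric_invader k (S : digraph k.+2) : Prop :=
  exists s : 'S_k.+2,
    [/\ s ord0 = ord_max, s ord_max = ord0 & forall i j, S (s i) (s j) = S i j].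

Section Invasion.
Variables (k : nat) (S : digraph k.+2) (n : nat) (G : digraph n).

(* The undirected edges of a simple graph, each one listed with its smaller
   endpoint first.  For symmetric S this choice of orientation does not affect
   the isomorphism class of the invaded digraph. *)
Definition uedge : Type :=
  {p : 'I_n * 'I_n | (p.1 < p.2)%N && (0 < G p.1 p.2)%N}.

(* The old vertices together with the k inner vertices of each copy of S. *)
Definition invaded_vertex : Type := ('I_n + uedge * 'I_k)%type.

(* Where the vertex i of the copy of S placed on e lands. *)
Definition copy_vertex (e : uedge) (i : 'I_k.+2) : invaded_vertex :=
  match unlift ord0 i with
  | None => inl (val e).1
  | Some j => match unlift ord_max j with
              | None => inl (val e).2
              | Some h => inr (e, h)
              end
  end.

Definition invade : digraph #|{: invaded_vertex}| :=
  \matrix_(x, y) (\sum_(e : uedge)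
     \sum_(i | copy_vertex e i == enum_val x)
       \sum_(j | copy_vertex e j == enum_val y) S i j)%N.

End Invasion.

Definition path_invader (k : nat) : digraph k.+2 :=
  \matrix_(i, j) nat_of_bool ((i.+1 == j :> nat) || (j.+1 == i :> nat)).

(* The two-vertex invader with p on the diagonal and q off the diagonal. *)
Definition two_vertex_invader (p q : nat) : digraph 2 :=
  \matrix_(i, j) (if i == j then p else q).

(* Main.v *)
(** Every condition is compared with (4). Write F_G(x, t, u) = det(xI + tD + uA),
    which is homogeneous of degree n.

    Invasions: eliminating the inner vertices by a Schur complement turns the
    determinant of an invaded graph into a factor depending only on S and the
    number of edges, times F_G(x, p, q); by symmetry of S, the quantities p and
    q depend only on S. The two-vertex invaders give F_G(x, -k, -1) and
    F_G(x, -1, -k). The path with k inner vertices gives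
    F_G(x U_(k+1), -U_k, -1) for Chebyshev polynomials U, and for large k the
    monomials in x U_(k+1) and U_k have distinct degrees.

    Markov chain function: det((a + b)I + D) mu_G = F_G(x (a + b) + a, x, 1). As
    G has no loops, the second coefficient of mu_G is a times the sum of the
    1 / (a + b + d_v), a logarithmic derivative, so mu_G determines the first
    factor.

    Zeta function: the numbers of primitive cycles with given length and number
    of backtracks determine, and are determined by, the traces of the powers of
    the weighted edge matrix W. By Newton's identities these are equivalent to
    det(1 - uW), which Bartholdi's formula expresses through
    F_G(1 - u^2 w^2, u^2 w, -u) with w = 1 - t. So (4) makes the zeta products
    agree factor by factor. Conversely, letting u tend to 0 through positive
    reals recovers the numbers of primitive cycles length by length. *)
Require Import Defs.
From mathcomp Require Import all_boot all_order perm all_algebra.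
From mathcomp Require Import complex reals.
From mathcomp Require Import boolp classical_sets topology normedtype sequences.
From mathcomp Require Import ring lra zify.

Set Implicit Arguments.
Unset Strict Implicit.
Unset Printing Implicit Defensive.

Import Order.TTheory GRing.Theory Num.Theory.

Local Open Scope ring_scope.

(** * Determinants indexed by a finite type *)

Section FinTypeDeterminant.
Variable R : comNzRingType.

(** Rows are indexed by darts, edges or disjoint unions of such types; by [det_reindex] the chosen
    enumeration is immaterial. *)
Definition fdet (T : finType) (f : T -> T -> R) : R :=
  \det (\matrix_(i, j < #|T|) f (enum_val i) (enum_val j)).

Lemma eq_fdet (T : finType) (f g : T -> T -> R) : f =2 g -> fdet f = fdet g.
Proof. by move=> fg; congr determinant; apply/matrixP => i j; rewrite !mxE. Qed.

(** Two enumerations differ by a permutation applied to rows and columns alike, so its sign occurs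
    squared. *)
Lemma det_reindex m (T : finType) (f : T -> T -> R) (h : 'I_m -> T) :
  bijective h -> \det (\matrix_(i, j < m) f (h i) (h j)) = fdet f.
Proof.
move=> bh; have Em : m = #|T| by rewrite -(bij_eq_card bh) card_ord.
subst m; have inj : injective (enum_rank \o h).
  by apply: inj_comp (bij_inj bh); apply: enum_rank_inj.
pose s := perm inj.
pose B := \matrix_(i, j < #|T|) f (enum_val i) (enum_val j).
have -> : \matrix_(i, j) f (h i) (h j) = row_perm s (col_perm s B).
  by apply/matrixP => i j; rewrite !mxE !permE /= !enum_rankK.
by rewrite row_permE col_permE !det_mulmx !det_perm odd_permV mulrCA -expr2 sqrr_sign mulr1.
Qed.

Lemma fdet_bij (T T' : finType) (f : T' -> T' -> R) (h : T -> T') :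
  bijective h -> fdet (fun x y => f (h x) (h y)) = fdet f.
Proof.
move=> bh; apply: (@det_reindex _ _ f (fun i => h (enum_val i))).
by apply: bij_comp bh _; apply: enum_val_bij.
Qed.

Lemma fdet_ord n (f : 'I_n -> 'I_n -> R) : fdet f = \det (\matrix_(i, j) f i j).
Proof. by rewrite -(@det_reindex n _ f id) //; exists id. Qed.

Lemma fdetM (T : finType) (f g : T -> T -> R) :
  fdet f * fdet g = fdet (fun x y => \sum_z f x z * g z y).
Proof.
rewrite -det_mulmx; congr determinant; apply/matrixP => i j; rewrite !mxE.
by rewrite [RHS]big_enum_val /=; apply: eq_bigr => k _; rewrite !mxE.
Qed.

Definition sum_ord (m p : nat) (T1 T2 : Type) (h1 : 'I_m -> T1) (h2 : 'I_p -> T2)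
  (i : 'I_(m + p)) : T1 + T2 :=
  match split i with inl a => inl (h1 a) | inr b => inr (h2 b) end.

Lemma sum_ord_bij (T1 T2 : finType) :
  bijective (sum_ord (@enum_val T1 T1) (@enum_val T2 T2)).
Proof.
exists (fun z => match z with
  | inl a => lshift _ (enum_rank a) | inr b => rshift _ (enum_rank b) end).
  move=> i; rewrite /sum_ord; case: (splitP i) => j Ej; rewrite enum_valK;
  exact: val_inj.
case=> a; rewrite /sum_ord.
  by rewrite -[lshift _ _]/(unsplit (inl _)) unsplitK enum_rankK.
by rewrite -[rshift _ _]/(unsplit (inr _)) unsplitK enum_rankK.
Qed.

Lemma sum_ord_lshift m p (T1 T2 : Type) (h1 : 'I_m -> T1) (h2 : 'I_p -> T2) i :
  sum_ord h1 h2 (lshift p i) = inl (h1 i).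
Proof. by rewrite /sum_ord -[lshift _ _]/(unsplit (inl _)) unsplitK. Qed.

Lemma sum_ord_rshift m p (T1 T2 : Type) (h1 : 'I_m -> T1) (h2 : 'I_p -> T2) i :
  sum_ord h1 h2 (rshift m i) = inr (h2 i).
Proof. by rewrite /sum_ord -[rshift _ _]/(unsplit (inr _)) unsplitK. Qed.

Lemma fdet_upper (T1 T2 : finType) (f : T1 + T2 -> T1 + T2 -> R) :
  (forall y x, f (inr y) (inl x) = 0) ->
  fdet f = fdet (fun x x' => f (inl x) (inl x')) *
           fdet (fun y y' => f (inr y) (inr y')).
Proof.
move=> f0; rewrite -(det_reindex f (sum_ord_bij T1 T2)).
rewrite -(det_ublock _ (\matrix_(i, j) f (inl (enum_val i)) (inr (enum_val j)))).
congr determinant; apply/matrixP => i j; rewrite mxE.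
case: (split_ordP i) => a ->; case: (split_ordP j) => b ->;
  rewrite ?(sum_ord_lshift, sum_ord_rshift);
  by rewrite ?(block_mxEul, block_mxEur, block_mxEdl, block_mxEdr) !mxE.
Qed.

Lemma fdet_lower (T1 T2 : finType) (f : T1 + T2 -> T1 + T2 -> R) :
  (forall x y, f (inl x) (inr y) = 0) ->
  fdet f = fdet (fun x x' => f (inl x) (inl x')) *
           fdet (fun y y' => f (inr y) (inr y')).
Proof.
move=> f0; have tr (T : finType) (g : T -> T -> R) : fdet g = fdet (fun x y => g y x).
  by rewrite /fdet -det_tr; congr determinant; apply/matrixP => i j; rewrite !mxE.
by rewrite tr fdet_upper // [fdet (fun x x' : T1 => _)]tr [fdet (fun x x' : T2 => _)]tr.
Qed.

Lemma fdet_scalar (T : finType) (c : R) :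
  fdet (fun x y : T => c *+ (x == y)) = c ^+ #|T|.
Proof.
rewrite -det_scalar; congr determinant; apply/matrixP => i j.
by rewrite !mxE (inj_eq enum_val_inj).
Qed.

End FinTypeDeterminant.

(** * The polynomial eta *)

Lemma evalX (A S : comNzRingType) (f : {rmorphism A -> S}) (y : S) :
  (horner_eval y \o map_poly f) 'X = y.
Proof. by rewrite /= map_polyX /horner_eval hornerX. Qed.

Lemma evalC (A S : comNzRingType) (f : {rmorphism A -> S}) (y : S) c :
  (horner_eval y \o map_poly f) c%:P = f c.
Proof. by rewrite /= map_polyC /horner_eval hornerC. Qed.

Section EtaAt.
Variables (n : nat).
Implicit Types G : digraph n.

Lemma eta_at_rmorph (R S : comNzRingType) (f : {rmorphism R -> S}) G x t u :
  f (eta_at G x t u) = eta_at G (f x) (f t) (f u).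
Proof.
rewrite /eta_at -det_map_mx; congr determinant; apply/matrixP => i j.
by rewrite !mxE !rmorphD !rmorphM !rmorphMn /= !rmorph1.
Qed.

Lemma eta_atM (R : comNzRingType) G (c x t u : R) :
  eta_at G (c * x) (c * t) (c * u) = c ^+ n * eta_at G x t u.
Proof.
by rewrite /eta_at -detZ; congr determinant; rewrite !scalerDr !scalerA scale_scalar_mx.
Qed.

Lemma eta_atN (R : comNzRingType) G (x t u : R) :
  eta_at G (- x) (- t) (- u) = (-1) ^+ n * eta_at G x t u.
Proof. by rewrite -eta_atM !mulN1r. Qed.

End EtaAt.

(** The arguments of [eta] are independent variables, so every triple in a commutative ring is
    reached by a ring morphism; [f1], [f2], [f3] evaluate u, t, x from the innermost ring
    outwards. *)
Lemma eta_eq_at (R : comNzRingType) n n' (G : digraph n) (G' : digraph n') (x t u : R) :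
  eta G = eta G' -> eta_at G x t u = eta_at G' x t u.
Proof.
pose f1 : {rmorphism _ -> R} := horner_eval u \o map_poly (intr : int -> R).
pose f2 : {rmorphism _ -> R} := horner_eval t \o map_poly f1.
pose f3 : {rmorphism _ -> R} := horner_eval x \o map_poly f2.
move=> /(congr1 f3); rewrite !eta_at_rmorph.
have -> : f3 'X = x by exact: evalX.
have -> : f3 'X%:P = t by rewrite [LHS]evalC [LHS]evalX.
by have -> : f3 'X%:P%:P = u by rewrite [LHS]evalC [LHS]evalC [LHS]evalX.
Qed.

(** Infinitely many common values force equality. Starting at 2 leaves out points where later
    substitutions degenerate, such as k = 1 in k^2 - 1. *)
Lemma poly_eq_nat (S : idomainType) (p q : {poly S}) :
  injective (fun k : nat => k%:R : S) ->
  (forall k : nat, (2 <= k)%N -> p.[k%:R] = q.[k%:R]) -> p = q.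
Proof.
move=> inj E; apply/eqP; rewrite -subr_eq0; apply: contraT => nz.
pose s := [seq (k.+2)%:R : S | k <- iota 0 (size (p - q))].
have := @max_poly_roots _ (p - q) s nz; rewrite size_map size_iota ltnn.
rewrite [all _ _](_ : _ = true) ?map_inj_uniq ?iota_uniq //; first exact.
  by move=> a b /inj [].
by apply/allP => _ /mapP [k _ ->]; rewrite /root !hornerE /= E ?subrr.
Qed.

Lemma natr_poly_inj (S : nzRingType) :
  injective (fun k : nat => k%:R : S) -> injective (fun k : nat => k%:R : {poly S}).
Proof. by move=> inj a b /(congr1 (fun p : {poly S} => p`_0));
  rewrite !coefMn !coef1 => /inj. Qed.

Lemma natr_int_inj : injective (fun k : nat => k%:R : int).
Proof. by move=> a b /eqP; rewrite eqr_nat => /eqP. Qed.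

(** * Recovering eta from integer values of t *)

Section EtaEquality.
Variable n : nat.
Implicit Types G : digraph n.

(** Interpolation makes the second argument generic, base change then gives all values with u = 1,
    and homogeneity in the fraction field removes this normalisation. *)
Lemma eta_eq_of_nat_int G G' :
  (forall k : nat, (2 <= k)%N ->
     eta_at G ('X : {poly int}) k%:R 1 = eta_at G' 'X k%:R 1) ->
  eta G = eta G'.
Proof.
move=> E.
have gen : eta_at G ('X%:P : {poly {poly int}}) 'X 1 = eta_at G' 'X%:P 'X 1.
  apply: poly_eq_nat => [|k k2]; first exact/natr_poly_inj/natr_int_inj.
  have := E k k2; rewrite -![_.[_]]/(horner_eval _ _) !eta_at_rmorph /= /horner_eval.
  by rewrite hornerC hornerX hornerC.
have at1 (K : comNzRingType) (y t : K) : eta_at G y t 1 = eta_at G' y t 1.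
  pose f1 : {rmorphism _ -> K} := horner_eval y \o map_poly (intr : int -> K).
  pose f2 : {rmorphism _ -> K} := horner_eval t \o map_poly f1.
  move: (congr1 f2 gen); rewrite !eta_at_rmorph.
  have -> : f2 'X = t by exact: evalX.
  by have -> : f2 'X%:P = y; [rewrite [LHS]evalC [LHS]evalX | rewrite rmorph1].
apply/eqP; rewrite -tofrac_eq; apply/eqP; rewrite !eta_at_rmorph /=.
set x := FracField.tofrac 'X; set t := FracField.tofrac _; set u := FracField.tofrac _.
have u0 : u != 0 by rewrite tofrac_eq0 !polyC_eq0 polyX_eq0.
have -> : eta_at G x t u = eta_at G (u * (x / u)) (u * (t / u)) (u * 1).
  by rewrite mulr1 ![u * _]mulrC !divfK.
have -> : eta_at G' x t u = eta_at G' (u * (x / u)) (u * (t / u)) (u * 1).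
  by rewrite mulr1 ![u * _]mulrC !divfK.
by rewrite !eta_atM at1.
Qed.

Lemma eta_eq_of_nat (K : numDomainType) G G' :
  (forall k : nat, (2 <= k)%N ->
     eta_at G ('X : {poly K}) k%:R 1 = eta_at G' 'X k%:R 1) ->
  eta G = eta G'.
Proof.
move=> E; apply: eta_eq_of_nat_int => k /E.
have mX (H : digraph n) :
    eta_at H ('X : {poly K}) k%:R 1 = map_poly (intr : int -> K) (eta_at H 'X k%:R 1).
  by rewrite eta_at_rmorph /= map_polyX rmorph_nat rmorph1.
by rewrite !mX; apply: map_inj_poly => //; apply: intr_inj.
Qed.

End EtaEquality.

(** * Invasions and Schur complements *)

Section SimpleGraphEdges.
Variables (n : nat) (G : digraph n).
Hypothesis hG : is_simple_graph G.

Lemma simple_graph_sym i j : G i j = G j i.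
Proof. by case: hG => GT _ _; rewrite -[in LHS]GT mxE. Qed.

Lemma simple_graphE i j : G i j = (0 < G i j)%N.
Proof. by case: hG => _ _ /(_ i j); case: (G i j) => [|[|]]. Qed.

(** The orientation stored in [uedge] disappears once both directions are summed; without loops the
    diagonal contributes nothing. *)
Lemma sum_uedge (V : nmodType) (g : 'I_n -> 'I_n -> V) :
  \sum_(e : uedge G) (g (val e).1 (val e).2 + g (val e).2 (val e).1) =
  \sum_i \sum_j g i j *+ G i j.
Proof.
have sub (f : 'I_n -> 'I_n -> V) : \sum_(e : uedge G) f (val e).1 (val e).2 =
    \sum_(i < n) \sum_(j < n | (i < j)%N) f i j *+ G i j.
  rewrite pair_big_dep /=.
  rewrite (eq_bigr (fun p : 'I_n * 'I_n => if (0 < G p.1 p.2)%N then f p.1 p.2 else 0));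
    last first.
    by move=> p _; rewrite simple_graphE; case: (0 < _)%N.
  rewrite -big_mkcondr /=.
  rewrite (reindex_omap (val : uedge G -> _) insub) /=; last first.
    by move=> p Pp; case: insubP => [u _ <-//|]; rewrite Pp.
  by apply: eq_big => //= e; rewrite valK eqxx (valP e).
rewrite big_split /= (sub g) (sub (fun i j => g j i)).
rewrite [X in _ + X](exchange_big_dep predT) //= -big_split /=.
apply: eq_bigr => i _; rewrite [RHS](bigID (fun j : 'I_n => (i < j)%N)) /=; congr (_ + _).
rewrite big_mkcond [RHS]big_mkcond; apply: eq_bigr => j _.
rewrite -leqNgt [(j <= i)%N]leq_eqVlt simple_graph_sym;
  case: (@eqP _ (j : nat) i) => [/val_inj ->|//].
by case: hG => _ -> _; rewrite ltnn mulr0n.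
Qed.

Lemma card_uedge : (#|{: uedge G}|.*2 = \sum_i \sum_j G i j)%N.
Proof.
transitivity (\sum_i \sum_j 1%N *+ G i j)%N; last first.
  by apply: eq_bigr => i _; apply: eq_bigr => j _; rewrite natn.
by rewrite -(sum_uedge (fun _ _ => 1%N)) sum_nat_const muln2.
Qed.

End SimpleGraphEdges.

Section InvadedDeterminant.
Variables (R : comNzRingType) (k : nat) (S : digraph k.+2) (n : nat) (G : digraph n).
Variables x t u : R.

Let s (i j : 'I_k.+2) : R := (t * (\sum_l S i l)%N%:R) *+ (i == j) + u * (S i j)%:R.
Let cv (e : uedge G) (i : 'I_k.+2) := copy_vertex e i.
Let inn (h : 'I_k) : 'I_k.+2 := lift ord0 (lift ord_max h).
Let E : finType := uedge G.

Lemma copy_vertex0 (e : E) : cv e ord0 = inl (val e).1.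
Proof. by rewrite /cv /copy_vertex unlift_none. Qed.

Lemma copy_vertex_max (e : E) : cv e ord_max = inl (val e).2.
Proof.
by rewrite /cv /copy_vertex (_ : ord_max = lift ord0 ord_max) ?liftK ?unlift_none //;
  apply: val_inj.
Qed.

Lemma copy_vertex_inner (e : E) h : cv e (inn h) = inr (e, h).
Proof. by rewrite /cv /copy_vertex /inn !liftK. Qed.

Lemma invader_vertexP (P : 'I_k.+2 -> Prop) :
  P ord0 -> P ord_max -> (forall h, P (inn h)) -> forall i, P i.
Proof.
move=> P0 Pm Pi i; case: (unliftP ord0 i) => [j ->|-> //].
case: (unliftP ord_max j) => [h ->|->]; first exact: Pi.
by rewrite (_ : lift _ _ = ord_max) //; apply: val_inj.
Qed.

Lemma inner_neq0 h : inn h != ord0.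
Proof. by []. Qed.

Lemma inner_neq_max h : inn h != ord_max.
Proof.
by rewrite -(inj_eq val_inj) /= /bump /= leqNgt ltn_ord add0n add1n eqSS ltn_eqF.
Qed.

Lemma sum_copy_inl (V : nmodType) (F : 'I_k.+2 -> V) (e : E) v :
  \sum_(i | cv e i == inl v) F i =
  F ord0 *+ ((val e).1 == v) + F ord_max *+ ((val e).2 == v).
Proof.
rewrite big_mkcond (bigD1 ord0) //= (bigD1 ord_max) //= copy_vertex0 copy_vertex_max.
rewrite big1 ?addr0 => [|i]; first by rewrite !mulrb.
by elim/invader_vertexP: i => [|/andP[_]|h _]; rewrite ?eqxx // copy_vertex_inner.
Qed.

Lemma sum_copy_inr (V : nmodType) (F : 'I_k.+2 -> V) (e : E) y :
  \sum_(i | cv e i == inr y) F i = F (inn y.2) *+ (e == y.1).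
Proof.
rewrite big_mkcond (bigD1 (inn y.2)) //= copy_vertex_inner.
rewrite big1 ?addr0 => [|i].
  by rewrite mulrb; case: y => e' h /=; rewrite (inj_eq inr_inj) xpair_eqE eqxx andbT.
elim/invader_vertexP: i => [||h]; rewrite ?copy_vertex0 ?copy_vertex_max //.
rewrite copy_vertex_inner; case: y => e' h'; rewrite (inj_eq inr_inj) xpair_eqE /=.
by case: (h =P h') => [->|_]; rewrite ?eqxx ?andbF.
Qed.

(** This is tD + uA of the invaded graph: out-degrees, like edges, add up over the copies, so each
    copy contributes its local matrix [s]. *)
Definition invaded_entry (X Y : invaded_vertex k G) : R :=
  \sum_e \sum_(i | cv e i == X) \sum_(j | cv e j == Y) s i j.

Lemma sum_copies (F : 'I_k.+2 -> R) (g : invaded_vertex k G -> R) e :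
  \sum_Y (\sum_(j | cv e j == Y) F j) * g Y = \sum_j F j * g (cv e j).
Proof.
under eq_bigr => Y _ do rewrite big_distrl big_mkcond /=.
rewrite exchange_big; apply: eq_bigr => j _ /=.
by rewrite (bigD1 (cv e j)) //= eqxx big1 ?addr0 // => Y; rewrite eq_sym => /negPf ->.
Qed.

Lemma eta_invade_fdet :
  eta_at (invade S G) x t u = fdet (fun X Y => x *+ (X == Y) + invaded_entry X Y).
Proof.
congr determinant; apply/matrixP => a b; rewrite !mxE -addrA (inj_eq enum_val_inj).
congr (_ + _).
have -> : (\sum_j invade S G a j = \sum_(e : E) \sum_(i | cv e i == enum_val a) \sum_j S i j)%N.
  under eq_bigr => j _ do rewrite mxE.
  rewrite -(big_enum_val (fun Y => \sum_e \sum_(i | copy_vertex e i == _)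
       \sum_(j | copy_vertex e j == Y) S i j)%N) /= exchange_big.
  apply: eq_bigr => e _; rewrite exchange_big; apply: eq_bigr => i _ /=.
  under eq_bigr => Y _ do rewrite big_mkcond /=.
  rewrite exchange_big; apply: eq_bigr => j _ /=.
  by rewrite (bigD1 (cv e j)) //= eqxx big1 ?addn0 // => Y; rewrite eq_sym => /negPf ->.
rewrite /invaded_entry !natr_sum mulrnAr mulr_sumr -sumrMnl mulr_sumr -big_split /=.
apply: eq_bigr => e _; rewrite !natr_sum mulr_sumr -sumrMnl mulr_sumr -big_split /=.
apply: eq_bigr => i /eqP ei; rewrite big_split /=; congr (_ + _); last first.
  by rewrite natr_sum mulr_sumr.
rewrite [RHS]big_mkcond [RHS](bigD1 i) //= eqxx ei (inj_eq enum_val_inj) [X in _ = _ + X]big1 => [|j].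
  by rewrite addr0; case: eqP.
by rewrite eq_sym => /negPf ->; case: ifP.
Qed.

Variable c : R.
Variables (zz : 'I_k.+2 -> R) (sigma : 'S_k.+2).
Hypothesis hG : is_simple_graph G.
Hypothesis sigma0 : sigma ord0 = ord_max.
Hypothesis sigma_max : sigma ord_max = ord0.
Hypothesis sigmaS : forall i j, S (sigma i) (sigma j) = S i j.
Hypothesis zz_max : zz ord_max = 0.
Hypothesis zz_inner :
  forall h, x * zz (inn h) + \sum_j s (inn h) j * zz j = 0.

Lemma local_entry_sigma i j : s (sigma i) (sigma j) = s i j.
Proof.
rewrite /s (inj_eq perm_inj) sigmaS; congr (_ * _%:R *+ _ + _).
by rewrite (reindex_inj (@perm_inj _ sigma)); apply: eq_bigr => l _.
Qed.

(* [zz] is a vector on the invader killed by its rows at inner vertices.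
   Placing [zz] and its mirror image on every copy gives columns which clear
   the lower left block of the matrix of the invaded graph. *)
Lemma eta_invade_schur :
  zz ord0 ^+ n * eta_at (invade S G) x t u =
  eta_at G (zz ord0 * x) (\sum_j s ord0 j * zz j) (\sum_j s ord_max j * zz j) *
  fdet (fun y y' : E * 'I_k => x *+ (y == y') + s (inn y.2) (inn y'.2) *+ (y.1 == y'.1)).
Proof.
pose r i := \sum_j s i j * zz j.
pose zz1 j := zz (sigma^-1%g j).
have r1 i : \sum_j s i j * zz1 j = r (sigma^-1%g i).
  rewrite (reindex_inj (@perm_inj _ sigma)); apply: eq_bigr => j _.
  by rewrite /zz1 permK -{1}(permKV sigma i) local_entry_sigma.
pose Zl (X : invaded_vertex k G) v : R := match X with
  | inl w => zz ord0 *+ (w == v)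
  | inr (e, h) => zz (inn h) *+ ((val e).1 == v) + zz1 (inn h) *+ ((val e).2 == v) end.
(* [Z] is block lower triangular with determinant [zz ord0 ^+ n]; the matrix of the invaded graph is
   multiplied by it on the right. *)
pose Z (X Y : invaded_vertex k G) : R :=
  match Y with inl v => Zl X v | inr y => (X == inr y)%:R end.
have s0 : sigma^-1%g ord_max = ord0 by rewrite -sigma0 permK.
have sm : sigma^-1%g ord0 = ord_max by rewrite -sigma_max permK.
(* Since [zz] vanishes at the last vertex and [zz1] at the first, one formula covers native and
   inner vertices. *)
have ZlE e j v : Zl (cv e j) v = zz j *+ ((val e).1 == v) + zz1 j *+ ((val e).2 == v).
  elim/invader_vertexP: j => [||h];
    rewrite ?copy_vertex0 ?copy_vertex_max ?copy_vertex_inner //=.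
    by rewrite /zz1 sm zz_max mul0rn addr0.
  by rewrite /zz1 s0 zz_max mul0rn add0r.
have detZ : fdet Z = zz ord0 ^+ n.
  rewrite fdet_lower //=.
  have -> : fdet (fun y y' : E * 'I_k => (inr y == inr y' :> invaded_vertex k G)%:R) = 1 ^+ #|{: E * 'I_k}| :> R.
    by rewrite -fdet_scalar; apply: eq_fdet => y y'; rewrite (inj_eq inr_inj).
  by rewrite expr1n mulr1 fdet_scalar card_ord.
rewrite -detZ mulrC eta_invade_fdet fdetM.
set P := (fun X Y => \sum_z _).
have PE X v : P X (inl v) = x * Zl X v +
    \sum_e \sum_(i | cv e i == X) (r i *+ ((val e).1 == v) + r (sigma^-1%g i) *+ ((val e).2 == v)).
  rewrite /P; under eq_bigr => Y _ do rewrite mulrDl.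
  rewrite big_split /=; congr (_ + _).
    rewrite (bigD1 X) //= eqxx big1 ?addr0 // => Y.
    by rewrite eq_sym => /negPf ->; rewrite mul0r.
  under eq_bigr => Y _ do rewrite /invaded_entry mulr_suml.
  rewrite exchange_big; apply: eq_bigr => e _ /=.
  under eq_bigr => Y _ do rewrite mulr_suml.
  rewrite exchange_big; apply: eq_bigr => i _ /=.
  rewrite sum_copies -r1 /r -!sumrMnl -big_split; apply: eq_bigr => j _ /=.
  by rewrite ZlE mulrDr !mulrnAr.
have Pr X y : P X (inr y) = x *+ (X == inr y) + invaded_entry X (inr y).
  rewrite /P (bigD1 (inr y)) //= eqxx mulr1 big1 ?addr0 // => Y /negPf ->.
  by rewrite mulr0.
(* Lower left block: the rows of inner vertices kill [zz], and also its mirror image because the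
   automorphism permutes the inner vertices. *)
rewrite fdet_upper => [|[e h] v]; last first.
  rewrite PE /= (eq_bigr (fun e' : E => (r (inn h) *+ ((val e').1 == v) +
     r (sigma^-1%g (inn h)) *+ ((val e').2 == v)) *+ (e' == e))); last first.
    by move=> e' _; rewrite sum_copy_inr.
  rewrite (bigD1 e) //= eqxx mulr1n big1 ?addr0 => [|e1 /negPf -> //].
  rewrite mulrDr !mulrnAr addrACA -!mulrnDl /r zz_inner mul0rn add0r /zz1.
  suff [h' ->] : exists h', sigma^-1%g (inn h) = inn h' by rewrite zz_inner mul0rn.
  move: (inner_neq0 h) (inner_neq_max h); set y := sigma^-1%g (inn h).
  have <- : sigma y = inn h by rewrite permKV.
  elim/invader_vertexP: y => [||h' _ _]; last by exists h'.
    by rewrite sigma0 eqxx.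
  by rewrite sigma_max eqxx.
congr (_ * _).
  rewrite fdet_ord /eta_at; congr determinant; apply/matrixP => v w; rewrite !mxE PE /=.
  rewrite mulrnAr mulrC -addrA; congr (_ + _).
  rewrite -!/(r _).
  (* Contribution of an edge, read from i to j, to the entry (v, w): a diagonal term when i = v = w,
     an off-diagonal one when (i, j) = (v, w). *)
  pose g i j := (r ord0 *+ (v == w)) *+ (i == v) + r ord_max *+ ((i == v) && (j == w)).
  rewrite (eq_bigr (fun e : E => g (val e).1 (val e).2 + g (val e).2 (val e).1)); last first.
    rewrite /g.
    move=> e _; rewrite sum_copy_inl s0 sm /= !mulrnDl -!mulrnA !mulnb.
    have lt : ((val e).1 == (val e).2) = false.
      by apply/negbTE; rewrite neq_ltn; case/andP: (valP e) => ->.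
    have [E1|E1] := eqVneq (val e).1 v; have [E2|E2] := eqVneq (val e).2 v;
      rewrite ?andbF ?andbT ?mulr0n ?add0r ?addr0 ?E1 ?E2 //.
      by rewrite E1 E2 eqxx in lt.
    by rewrite addrC.
  rewrite (sum_uedge hG g) /g (bigD1 v) //= [X in _ + X]big1 => [|i /negPf iv].
    rewrite addr0 eqxx mulr1n; under eq_bigr => j _ do rewrite mulrnDl.
    rewrite big_split /=; congr (_ + _).
      by rewrite mulrnAr natr_sum mulr_sumr -[RHS]sumrMnl; apply: eq_bigr => j _;
        rewrite mulr_natr mulrnAC.
    rewrite (bigD1 w) //= eqxx big1 ?addr0 ?mulr_natr // => j /negPf ->.
    by rewrite mul0rn.
  by rewrite big1 // => j _; rewrite iv mulr0n addr0 mul0rn.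
apply: eq_fdet => y y'; rewrite Pr (inj_eq inr_inj); congr (_ + _).
rewrite /invaded_entry (bigD1 y.1) //= [X in _ + X]big1 => [|e /negPf ne].
  by rewrite sum_copy_inr eqxx mulr1n addr0 sum_copy_inr.
by rewrite sum_copy_inr ne.
Qed.

End InvadedDeterminant.

Lemma card_eq_bij (T T' : finType) : #|T| = #|T'| -> exists h : T -> T', bijective h.
Proof.
move=> E; exists (fun x => enum_val (cast_ord E (enum_rank x))).
exists (fun y => enum_val (cast_ord (esym E) (enum_rank y))) => x.
  by rewrite enum_valK cast_ordK enum_rankK.
by rewrite enum_valK cast_ordKV enum_rankK.
Qed.

Lemma chi_eta_at n (G : digraph n) : chi G = eta_at G ('X : {poly int}) 0 (-1).
Proof.
rewrite /chi /char_poly /eta_at scale0r addr0; congr determinant.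
by apply/matrixP => i j; rewrite !mxE mulN1r rmorph_nat.
Qed.

(** At t = -1 and u = 0 the determinant is the characteristic polynomial of the degree matrix, whose
    trace is this sum. *)
Lemma eta_edge_count n (G G' : digraph n) :
  eta G = eta G' -> (\sum_i \sum_j G i j = \sum_i \sum_j G' i j)%N.
Proof.
case: n G G' => [|n] G G' E; first by rewrite !big_ord0.
have tr (H : digraph n.+1) : \tr (outdegmx int H) = (\sum_i \sum_j H i j)%N%:R.
  by rewrite mxtrace_diag natr_sum; apply: eq_bigr => i _; rewrite mxE.
have cp (H : digraph n.+1) :
    char_poly (outdegmx int H) = eta_at H ('X : {poly int}) (-1) 0.
  rewrite /char_poly /eta_at scale0r addr0; congr determinant.
  by apply/matrixP => i j; rewrite !mxE rmorphMn rmorph_nat mulN1r.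
have := congr1 (fun p : {poly int} => p`_n) (eta_eq_at ('X : {poly int}) (-1) 0 E).
rewrite -!cp !(char_poly_trace _ (ltn0Sn n)) => /oppr_inj.
by rewrite !tr => /eqP; rewrite eqr_nat => /eqP.
Qed.

Lemma eta_card_uedge n (G G' : digraph n) : is_simple_graph G -> is_simple_graph G' ->
  eta G = eta G' -> #|{: uedge G}| = #|{: uedge G'}|.
Proof.
move=> hG hG' /eta_edge_count; rewrite -(card_uedge hG) -(card_uedge hG').
exact: double_inj.
Qed.

Section InnerBlock.
Variables (R : comNzRingType) (k : nat) (b : 'I_k -> 'I_k -> R).

(** The inner vertices give one identical block per copy, so only the number of copies matters. *)
Lemma inner_block_card (E E' : finType) : #|E| = #|E'| ->
  fdet (fun y y' : E * 'I_k => b y.2 y'.2 *+ (y.1 == y'.1)) =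
  fdet (fun y y' : E' * 'I_k => b y.2 y'.2 *+ (y.1 == y'.1)).
Proof.
move=> /card_eq_bij [h bh].
rewrite -(@fdet_bij _ _ _ _ (fun y : E * 'I_k => (h y.1, y.2))).
  by apply: eq_fdet => y y' /=; rewrite (bij_eq bh).
by case: bh => g hK gK; exists (fun y => (g y.1, y.2)) => -[a i] /=; rewrite ?hK ?gK.
Qed.

End InnerBlock.

Lemma fdet_monic (K : idomainType) (T : finType) (f : T -> T -> K) :
  fdet (fun y y' => 'X *+ (y == y') + (f y y')%:P) \is monic.
Proof.
have -> : fdet (fun y y' => 'X *+ (y == y') + (f y y')%:P) =
    char_poly (\matrix_(i, j < #|T|) - f (enum_val i) (enum_val j)).
  rewrite /char_poly /fdet; congr determinant; apply/matrixP => i j.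
  by rewrite !mxE (inj_eq enum_val_inj) rmorphN opprK.
exact: char_poly_monic.
Qed.

Section Invaders.
Variables (n : nat) (G G' : digraph n).
Hypotheses (hG : is_simple_graph G) (hG' : is_simple_graph G').

(** The vector for the Schur complement comes from Cramer's rule: det m at the first vertex, minus
    adj(m) times the column of that vertex at the inner ones. No division occurs until a power of
    det m is cancelled at the end. *)
Lemma eta_invade_eq k (S : digraph k.+2) : symmetric_invader S ->
  eta G = eta G' -> eta (invade S G) = eta (invade S G').
Proof.
move=> [sg [s0 sm sS]] E.
pose A := {poly {poly int}}; pose u : {poly A} := 'X%:P%:P; pose t : {poly A} := 'X%:P.
pose s (i j : 'I_k.+2) : {poly A} := (t * (\sum_l S i l)%N%:R) *+ (i == j) + u * (S i j)%:R.
pose inn (h : 'I_k) : 'I_k.+2 := lift ord0 (lift ord_max h).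
pose s' (i j : 'I_k.+2) : A := ('X * (\sum_l S i l)%N%:R) *+ (i == j) + 'X%:P * (S i j)%:R.
have ss' i j : s i j = (s' i j)%:P.
  by rewrite /s /s' rmorphD rmorphMn !rmorphM !rmorph_nat.
pose m := \matrix_(i, j < k) ('X *+ (i == j) + s (inn i) (inn j)) : 'M[{poly A}]_k.
pose z h := - \sum_h' \adj m h h' * s (inn h') ord0.
pose zz (i : 'I_k.+2) : {poly A} := match unlift ord0 i with
  | None => \det m
  | Some j => match unlift ord_max j with None => 0 | Some h => z h end end.
have zz0 : zz ord0 = \det m by rewrite /zz unlift_none.
have zzm : zz ord_max = 0.
  by rewrite /zz (_ : ord_max = lift ord0 ord_max) ?liftK ?unlift_none //; apply: val_inj.
have zzi h : zz (inn h) = z h by rewrite /zz /inn !liftK.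
have sum_split (F : 'I_k.+2 -> {poly A}) :
    \sum_j F j = F ord0 + \sum_h F (inn h) + F ord_max.
  rewrite big_ord_recl big_ord_recr /= addrA; congr (_ + _ + F _); last exact: val_inj.
  apply: eq_bigr => h _; congr F; apply: val_inj.
  by rewrite /= [bump k h]/bump leqNgt ltn_ord.
have zz_inner h : 'X * zz (inn h) + \sum_j s (inn h) j * zz j = 0.
  rewrite sum_split zz0 zzm mulr0 addr0 addrCA.
  have -> : 'X * zz (inn h) + \sum_h' s (inn h) (inn h') * zz (inn h') = \sum_h' m h h' * z h'.
    rewrite (bigD1 h) //= [in RHS](bigD1 h) //= addrA !zzi -mulrDl.
    congr (_ + _); first by rewrite mxE eqxx mulr1n.
    apply: eq_bigr => h' /negPf hh'.
    by rewrite zzi mxE eq_sym hh' add0r.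
  have -> : \sum_h' m h h' * z h' = - \sum_h'' (m *m \adj m) h h'' * s (inn h'') ord0.
    under eq_bigr => h' _ do rewrite /z mulrN mulr_sumr.
    rewrite sumrN exchange_big; congr (- _); apply: eq_bigr => h'' _.
    by rewrite mxE mulr_suml; apply: eq_bigr => h' _; rewrite mulrA.
  rewrite mul_mx_adj (bigD1 h) //= mxE eqxx big1 => [|h'' /negPf hh''].
    by rewrite addr0 [_ * s _ _]mulrC subrr.
  by rewrite mxE eq_sym hh'' mul0r.
have := eta_invade_schur hG s0 sm sS zzm zz_inner.
have := eta_invade_schur hG' s0 sm sS zzm zz_inner.
rewrite (eta_eq_at _ _ _ E).
have inner (H : digraph n) : fdet (fun y y' : uedge H * 'I_k =>
     'X *+ (y == y') + s (inn y.2) (inn y'.2) *+ (y.1 == y'.1)) =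
   fdet (fun y y' : uedge H * 'I_k => m y.2 y'.2 *+ (y.1 == y'.1)).
  apply: eq_fdet => -[e h] [e' h']; rewrite mxE xpair_eqE /= [RHS]mulrnDl.
  by congr (_ + _); rewrite -mulrnA mulnb andbC.
rewrite !inner (inner_block_card _ (eta_card_uedge hG hG' E)) => <-.
apply: mulfI; rewrite expf_neq0 // zz0.
(* The matrix [m] is x times the identity plus a matrix free of x, so its determinant is monic in
   x. *)
have -> : \det m = fdet (fun i j : 'I_k => 'X *+ (i == j) + (s' (inn i) (inn j))%:P).
  by rewrite fdet_ord; congr determinant; apply/matrixP => i j; rewrite !mxE ss'.
exact/monic_neq0/fdet_monic.
Qed.

Lemma symmetric_two_vertex p q : symmetric_invader (two_vertex_invader p q).
Proof.
have E0 : ord_max = lift ord0 ord0 :> 'I_2 by apply: val_inj.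
exists (tperm ord0 ord_max); rewrite tpermL tpermR; split=> // i j.
by rewrite !mxE (inj_eq perm_inj).
Qed.

Lemma symmetric_path k : symmetric_invader (path_invader k).
Proof.
exists (perm (@rev_ord_inj k.+2)); rewrite !permE; split; try by apply: val_inj;
  rewrite /= ?subn1 ?subnn.
move=> i j; rewrite !mxE !permE /=; congr nat_of_bool.
by have := ltn_ord i; have := ltn_ord j; lia.
Qed.

End Invaders.

(** * Two-vertex invaders and paths *)

Lemma chi_two_vertex n (G : digraph n) p q : is_simple_graph G ->
  chi (invade (two_vertex_invader p q) G) =
  eta_at G ('X : {poly int}) (- p%:R) (- q%:R).
Proof.
move=> hG; have [sg [s0 sm sS]] := symmetric_two_vertex p q.
(* Without inner vertices the indicator of the first vertex meets all conditions, and the inner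
   determinant is empty. *)
pose zz (i : 'I_2) : {poly int} := (i == ord0)%:R.
have zm : zz ord_max = 0 by [].
have zi (h : 'I_0) : 'X * zz (lift ord0 (lift ord_max h)) + \sum_j ((0 * (\sum_l
    two_vertex_invader p q (lift ord0 (lift ord_max h)) l)%N%:R) *+
    (lift ord0 (lift ord_max h) == j) +
    -1 * (two_vertex_invader p q (lift ord0 (lift ord_max h)) j)%:R) * zz j = 0.
  by case: h.
have := eta_invade_schur hG s0 sm sS zm zi.
rewrite {1 2}/zz eqxx expr1n !mul1r -chi_eta_at => ->.
have sum2 (F : 'I_2 -> {poly int}) : \sum_j F j * zz j = F ord0.
  by rewrite !big_ord_recl big_ord0 /zz mulr1 mulr0 !addr0.
rewrite !sum2 !mul0r !mul0rn !add0r !mulN1r !mxE /=.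
rewrite (_ : fdet _ = 1 ^+ #|{: uedge G * 'I_0}|) ?expr1n ?mulr1 //.
rewrite -[1 in RHS](expr1n _ #|{: uedge G * 'I_0}|) -fdet_scalar.
by apply: eq_fdet => -[e []].
Qed.

(** The invaders give the arguments (x, -k, -1); replacing x by -x and homogeneity turn them into
    (x, k, 1). *)
Lemma eta_of_two_vertex_loops n (G G' : digraph n) :
  is_simple_graph G -> is_simple_graph G' ->
  (forall k : nat, (0 < k)%N -> chi (invade (two_vertex_invader k 1) G) =
     chi (invade (two_vertex_invader k 1) G')) -> eta G = eta G'.
Proof.
move=> hG hG' E; apply: (@eta_eq_of_nat _ int) => k k2.
have := E k (ltnW k2); rewrite !chi_two_vertex // => /(congr1 (comp_poly (- 'X))).
rewrite !eta_at_rmorph /= comp_polyX !rmorphN /= rmorph_nat rmorph1 !eta_atN.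
by apply: mulfI; rewrite expf_neq0 // oppr_eq0 oner_neq0.
Qed.

(** Here k sits in the last argument and is first replaced by a variable. Setting this variable to
    1/k and x to -x/k, and multiplying by (-k)^n, yields (x, k, 1). *)
Lemma eta_of_two_vertex_edges n (G G' : digraph n) :
  is_simple_graph G -> is_simple_graph G' ->
  (forall k : nat, (0 < k)%N -> chi (invade (two_vertex_invader 1 k) G) =
     chi (invade (two_vertex_invader 1 k) G')) -> eta G = eta G'.
Proof.
move=> hG hG' E.
have gen : eta_at G ('X%:P : {poly {poly int}}) (-1) (- 'X) = eta_at G' 'X%:P (-1) (- 'X).
  apply: poly_eq_nat => [|k k2]; first exact/natr_poly_inj/natr_int_inj.
  have := E k (ltnW k2); rewrite !chi_two_vertex //.
  rewrite -![_.[_]]/(horner_eval _ _) !eta_at_rmorph !rmorphN !rmorph1 /= /horner_eval.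
  by rewrite hornerC hornerX.
apply: (@eta_eq_of_nat _ rat) => k k2.
have k0 : k%:R != 0 :> rat by rewrite pnatr_eq0; case: k k2.
pose f1 : {rmorphism _ -> {poly rat}} :=
  horner_eval (- (k%:R^-1)%:P * 'X) \o map_poly (intr : int -> {poly rat}).
pose f2 : {rmorphism _ -> {poly rat}} := horner_eval ((k%:R^-1)%:P) \o map_poly f1.
move: (congr1 f2 gen); rewrite !eta_at_rmorph.
have -> : f2 'X%:P = - (k%:R^-1)%:P * 'X by rewrite [LHS]evalC [LHS]evalX.
have -> : f2 (- 'X) = - (k%:R^-1)%:P by rewrite rmorphN [f2 _]evalX.
rewrite rmorphN rmorph1 => /(congr1 (fun p => (- k%:R) ^+ n * p)).
have kk : k%:R * (k%:R^-1)%:P = 1 :> {poly rat} by rewrite -polyC_natr -polyCM divff.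
by rewrite -!eta_atM !mulrNN mulrA mulrNN kk mul1r mulr1.
Qed.

(** Among the terms with nonzero coefficient, the one of largest degree has a leading term that no
    other can cancel. *)
Lemma monic_size_free (K : idomainType) (I : finType) (F : I -> {poly K}) (c : I -> K) :
  (forall i, F i \is monic) -> injective (fun i => size (F i)) ->
  \sum_i c i *: F i = 0 -> forall i, c i = 0.
Proof.
move=> mon inj sum0 i0; apply/eqP; apply: contraT => c0.
have [i ci maxi] := @arg_maxnP _ i0 (fun i => c i != 0) (fun i => size (F i)) c0.
have := congr1 (fun p : {poly K} => p`_(size (F i)).-1) sum0.
rewrite coef_sum coef0 (bigD1 i) //= coefZ -/(lead_coef _) (monicP (mon i)) mulr1.
rewrite big1 ?addr0 => [/eqP|j ji]; first by rewrite (negPf ci).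
rewrite coefZ; have [->|cj] := eqVneq (c j) 0; first by rewrite mul0r.
rewrite nth_default ?mulr0 // -ltnS prednK ?size_poly_gt0 ?monic_neq0 //.
rewrite ltn_neqAle [X in _ && X]maxi // andbT; apply: contra ji => /eqP e.
exact/eqP/inj.
Qed.

(* [cheb k.+1] is the characteristic polynomial of a path with k vertices. *)
Section Chebyshev.

Fixpoint cheb_pair (k : nat) : {poly int} * {poly int} :=
  match k with
  | 0 => (0, 1)
  | j.+1 => let: (a, b) := cheb_pair j in (b, 'X * b - a)
  end.

Definition cheb k := (cheb_pair k).1.

Lemma chebSS k : cheb k.+2 = 'X * cheb k.+1 - cheb k.
Proof. by rewrite /cheb /=; case: (cheb_pair k). Qed.

Lemma cheb_monic k : (size (cheb k) = k) /\ (cheb k.+1 \is monic).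
Proof.
suff [] : [/\ size (cheb k) = k, size (cheb k.+1) = k.+1 & cheb k.+1 \is monic] by [].
elim: k => [|k [s0 s1 m1]]; first by rewrite /cheb /= size_poly0 size_poly1 monic1.
have sX : size ('X * cheb k.+1)%R = k.+2 by rewrite mulrC size_mulX ?monic_neq0 ?s1.
have lt : (size (- cheb k)%R < size ('X * cheb k.+1)%R)%N by rewrite sX size_polyN s0 leqW.
by rewrite chebSS; split;
  rewrite ?size_polyDl // monicE lead_coefDl // lead_coefM (monicP m1) lead_coefX mulr1.
Qed.

End Chebyshev.

(** The determinant [d] of the inner blocks depends only on the number of edges, so one [d] serves
    all graphs with as many edges as [G]. *)
Lemma chi_path n (G : digraph n) k : is_simple_graph G ->
  exists2 d : {poly int}, d \is monic &
  forall G' : digraph n, is_simple_graph G' -> #|{: uedge G}| = #|{: uedge G'}| ->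
  cheb k.+1 ^+ n * chi (invade (path_invader k) G') =
  eta_at G' (cheb k.+1 * 'X) (- cheb k) (-1) * d.
Proof.
move=> hG.
pose inn (h : 'I_k) : 'I_k.+2 := lift ord0 (lift ord_max h).
pose s (i j : 'I_k.+2) : {poly int} :=
  (0 * (\sum_l path_invader k i l)%N%:R) *+ (i == j) + -1 * (path_invader k i j)%:R.
pose D (H : digraph n) : {poly int} := fdet (fun y y' : uedge H * 'I_k =>
  'X *+ (y == y') + s (inn y.2) (inn y'.2) *+ (y.1 == y'.1)).
have innE h : inn h = h.+1 :> nat by rewrite /= [bump k h]/bump leqNgt ltn_ord.
exists (D G).
  rewrite /D -(@eq_fdet _ _ (fun y y' : uedge G * 'I_k => 'X *+ (y == y') +
     (- (path_invader k (inn y.2) (inn y'.2))%:R *+ (y.1 == y'.1))%:P)).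
    exact: fdet_monic.
  by move=> y y'; rewrite /s mul0r mul0rn add0r mulN1r rmorphMn rmorphN rmorph_nat.
move=> G' hG' cardE; have [sg [s0 sm sS]] := symmetric_path k.
(* Along the path the inner condition is the three-term recurrence of [cheb], run backwards from the
   value 0 at the last vertex. *)
pose zz (i : 'I_k.+2) := cheb (k.+1 - i).
have zm : zz ord_max = 0 by rewrite /zz /= subnn.
have sE i j : s i j = - (path_invader k i j)%:R by rewrite /s mul0r mul0rn add0r mulN1r.
have zi h : 'X * zz (inn h) + \sum_j s (inn h) j * zz j = 0.
  have hk := ltn_ord h.
  have h1 : (h < k.+2)%N by lia.
  have h2 : (h.+2 < k.+2)%N by lia.
  rewrite (bigD1 (Ordinal h1)) //= (bigD1 (Ordinal h2)) //=; last first.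
    by rewrite -(inj_eq val_inj) /=; lia.
  rewrite big1 => [|j].
    rewrite /zz !sE !mxE !innE /= !eqxx orbT /= subSS addr0 !mulN1r.
    have -> : (k.+1 - h = (k - h.+1).+2)%N by lia.
    have -> : (k - h = (k - h.+1).+1)%N by lia.
    by rewrite chebSS subSS; ring.
  rewrite -!(inj_eq val_inj) /= => /andP[j1 j2].
  rewrite sE !mxE innE (_ : _ || _ = false) ?oppr0 ?mul0r //.
  by apply/negbTE; lia.
have := eta_invade_schur hG' s0 sm sS zm zi.
rewrite -chi_eta_at {1 2}/zz subn0 => ->.
have -> : \sum_j s ord0 j * zz j = - cheb k.
  rewrite (bigD1 (lift ord0 ord0)) //= big1 => [|j].
    by rewrite sE mxE /= mulN1r addr0 /zz subSS subn0.
  rewrite -!(inj_eq val_inj) /= => j1.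
  rewrite sE !mxE (_ : _ || _ = false) ?oppr0 ?mul0r //.
  by apply/negbTE; move: j1; rewrite /= /bump /=; lia.
have -> : \sum_j s ord_max j * zz j = -1.
  have k1 : (k < k.+2)%N by lia.
  rewrite (bigD1 (Ordinal k1)) //= big1 => [|j].
    by rewrite sE mxE /= eqxx orbT mulN1r addr0 /zz /= subSn // subnn.
  rewrite -!(inj_eq val_inj) /= => j1.
  rewrite sE !mxE (_ : _ || _ = false) ?oppr0 ?mul0r //.
  by apply/negbTE; move: j1 (ltn_ord j); rewrite /=; lia.
congr (_ * _); have inner (H : digraph n) : D H =
   fdet (fun y y' : uedge H * 'I_k => ('X *+ (y.2 == y'.2) + s (inn y.2) (inn y'.2)) *+ (y.1 == y'.1)).
  apply: eq_fdet => -[e h] [e' h']; rewrite xpair_eqE /= [RHS]mulrnDl.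
  by congr (_ + _); rewrite -mulrnA mulnb andbC.
rewrite -/(D G') !inner; apply/esym.
exact: (inner_block_card (fun h h' => 'X *+ (h == h') + s (inn h) (inn h'))).
Qed.

Lemma eta_of_path n (G G' : digraph n) : is_simple_graph G -> is_simple_graph G' ->
  (forall k : nat, chi (invade (path_invader k) G) = chi (invade (path_invader k) G')) ->
  eta G = eta G'.
Proof.
move=> hG hG' E.
have cardE : #|{: uedge G}| = #|{: uedge G'}|.
  (* A path with one inner vertex adds one vertex per edge, so the degree of [chi] reveals the
     number of edges. *)
  have := congr1 (fun p : {poly int} => size p) (E 1%N);
    rewrite !size_char_poly !card_sum !card_prod !card_ord.
  by rewrite !muln1 => -[] /addnI.
pose PG (H : digraph n) := eta_at H ('X%:P : {poly {poly int}}) (- 'X) (-1).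
pose P : {poly {poly int}} := PG G - PG G'.
suff P0 : P = 0.
  (* Setting the outer variable of [P] to k gives the arguments that belong to two-vertex invaders
     with k loops. *)
  apply: eta_of_two_vertex_loops => // k _; rewrite !chi_two_vertex //.
  have /eqP := P0; rewrite subr_eq0 => /eqP /(congr1 (horner_eval k%:R)).
  rewrite !eta_at_rmorph !rmorphN !rmorph1 /= /horner_eval hornerC hornerX.
  by [].
(* With k > 2 N the degrees (i + j) k + (i - j) of a^i b^j, i, j < N, are distinct. *)
pose N := maxn (size P) (\max_(j < size P) size (P`_j)%R).
pose k := N.*2.+2.
pose a : {poly int} := cheb k.+1 * 'X; pose b := cheb k.
have [sb mb] : size b = k /\ b \is monic by have [-> _] := cheb_monic k;
  have [] := cheb_monic k.-1.
have [sa ma] : size a = k.+2 /\ a \is monic.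
  have [s1 _] := cheb_monic k.+1; have [_ m1] := cheb_monic k.
  by rewrite /a size_mulX ?monic_neq0 // s1 monicMr ?monicX.
have Pab : \sum_(j < N) \sum_(i < N) P`_j`_i *: (a ^+ i * b ^+ j) = 0.
  have [d md dE] := chi_path k hG.
  have := dE G' hG' cardE; rewrite -E dE // => /(mulIf (monic_neq0 md)) PE.
  pose f1 : {rmorphism _ -> {poly int}} := horner_eval a \o map_poly (intr : int -> {poly int}).
  pose f2 : {rmorphism _ -> {poly int}} := horner_eval b \o map_poly f1.
  have f20 : f2 P = 0.
    rewrite rmorphB !eta_at_rmorph !rmorphN !rmorph1.
    have -> : f2 'X%:P = a by rewrite [LHS]evalC [LHS]evalX.
    have -> : f2 'X = b by rewrite [LHS]evalX.
    by rewrite PE subrr.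
  rewrite -[RHS]f20 -[RHS]/((map_poly f1 P).[b]) (@horner_coef_wide _ N); last first.
    by apply: leq_trans (size_poly _ _) _; rewrite leq_maxl.
  apply: eq_bigr => j _;
    rewrite coef_map -[X in _ = X * _]/((map_poly intr P`_j).[a]) (@horner_coef_wide _ N).
    rewrite mulr_suml; apply: eq_bigr => i _.
    by rewrite coef_map /= -mulrA -mul_polyC -{1}[P`_j`_i]intz rmorph_int.
  apply: leq_trans (size_poly _ _) _.
  have [lj|lj] := ltnP j (size P); last by rewrite nth_default ?size_poly0.
  by rewrite leq_max orbC (leq_bigmax (Ordinal lj)).
have co : forall ij : 'I_N * 'I_N, P`_ij.2`_ij.1 = 0.
  apply: (@monic_size_free _ _ (fun ij : 'I_N * 'I_N => a ^+ ij.1 * b ^+ ij.2)).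
  - by move=> ij; rewrite rpredM ?rpredX.
  - move=> [i j] [i' j'] /=; rewrite !size_monicM ?rpredX ?monic_neq0 ?rpredX //.
    have sz (p : {poly int}) l : p \is monic -> size (p ^+ l) = ((size p).-1 * l).+1.
      by move=> mp; rewrite -size_exp prednK // size_poly_gt0 monic_neq0 // rpredX.
    rewrite !sz // sa sb /= => e.
    (* The degrees i(k + 1) + j(k - 1), rearranged without subtraction. The remainders i + j' and i'
       + j are below k, so i + j is determined first. *)
    have {}e : ((i + j) * k + i + j' = (i' + j') * k + i' + j)%N by rewrite /k in e *; lia.
    have [hi hj hi' hj'] := And4 (ltn_ord i) (ltn_ord j) (ltn_ord i') (ltn_ord j').
    have le (x y : nat) : (x < y)%N -> (x * k + k <= y * k)%N.
      by move=> xy; rewrite addnC -mulSn leq_mul2r xy orbT.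
    have hs : (i + j = i' + j')%N.
      by have [/le|/le|//] := ltngtP (i + j)%N (i' + j')%N; rewrite /k in e *; lia.
    by rewrite hs in e; congr (_, _); apply: val_inj => /=; lia.
  - by rewrite -[RHS]Pab exchange_big pair_big.
apply/polyP => j; rewrite coef0; have [lj|lj] := ltnP j (size P); last by rewrite nth_default.
apply/polyP => i; rewrite coef0; have [li|li] := ltnP i (size (P`_j)%R);
  last by rewrite nth_default.
have lN : (size P <= N)%N by rewrite leq_maxl.
have lN' : (size (P`_j)%R <= N)%N by rewrite leq_max orbC (leq_bigmax (Ordinal lj)).
exact: (co (Ordinal (leq_trans li lN'), Ordinal (leq_trans lj lN))).
Qed.

(** * The Markov chain function *)

Lemma deriv_prod_ord (R : comNzRingType) n (f : 'I_n -> {poly R}) :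
  (\prod_i f i)^`() = \sum_i \prod_j (if j == i then (f j)^`() else f j).
Proof.
elim: n f => [|n IH] f; first by rewrite !big_ord0 -[1]/(1%:P) derivC.
rewrite big_ord_recr derivM /= IH big_ord_recr /= mulr_suml; congr (_ + _).
  apply: eq_bigr => i _; rewrite big_ord_recr /=.
  have -> : (ord_max == widen_ord (leqnSn n) i) = false.
    by rewrite -(inj_eq val_inj) /= gtn_eqF.
  by [].
rewrite big_ord_recr /= eqxx; congr (_ * _); apply: eq_bigr => j _.
by rewrite -(inj_eq val_inj) /= ltn_eqF.
Qed.

(* The leading coefficient of D' Q = Q' D, with D = P - Q, forces D to have the
   degree of Q. *)
Lemma monic_log_deriv_eq (P Q : {poly int}) : P \is monic -> Q \is monic ->
  size P = size Q -> P^`() * Q = Q^`() * P -> P = Q.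
Proof.
move=> mP mQ sPQ E; apply/eqP; rewrite -subr_eq0; apply: contraT => d0.
set D := P - Q in d0 *.
have sD : (size D < size Q)%N.
  have lt : (size D <= size Q)%N by rewrite (leq_trans (size_polyD _ _)) // size_polyN sPQ maxnn.
  rewrite ltn_neqAle lt andbT; apply/negP => /eqP sE.
  move: d0; rewrite -lead_coef_eq0 /lead_coef sE coefB -{1}sPQ.
  by rewrite -![_`_(size _).-1]/(lead_coef _) (monicP mP) (monicP mQ) subrr eqxx.
have DE : D^`() * Q = Q^`() * D.
  by rewrite derivB mulrBl E mulrBr.
have sD0 : (0 < size D)%N by rewrite size_poly_gt0.
have leadd (p : {poly int}) : (1 < size p)%N ->
    size p^`() = (size p).-1 /\ lead_coef p^`() = lead_coef p *+ (size p).-1.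
  case E1: (size p) => [|[|m]] // _.
  have lp : p`_m.+1 = lead_coef p by rewrite lead_coefE E1.
  have s : size p^`() = m.+1.
    rewrite /deriv E1 size_poly_eq //= lp mulrn_eq0 /= lead_coef_eq0.
    by rewrite -[p == 0]size_poly_eq0 E1.
  by split=> //; rewrite lead_coefE s coef_deriv lp.
have [_ lQ] := leadd Q (leq_ltn_trans sD0 sD).
have := congr1 lead_coef DE; rewrite !lead_coefM lQ (monicP mQ) mulr1.
have [sD1|sD1] := leqP (size D) 1.
  rewrite [D^`()](_ : _ = 0); last by rewrite [D]size1_polyC // derivC.
  rewrite lead_coef0 => /esym/eqP; rewrite mulf_eq0 lead_coef_eq0 (negPf d0) orbF.
  by rewrite pnatr_eq0; move: sD0 sD; lia.
have [_ ->] := leadd D sD1; rewrite -mulr_natl => /eqP.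
rewrite (inj_eq (mulIf _)) ?lead_coef_eq0 // eqr_nat.
by move: sD0 sD sD1; lia.
Qed.

Section IntegerPolynomialEvaluation.

Definition int_eval (S : comNzRingType) (y : S) : {rmorphism {poly int} -> S} :=
  horner_eval y \o map_poly (intr : int -> S).

Lemma int_evalX (S : comNzRingType) (y : S) : int_eval y 'X = y.
Proof. exact: evalX. Qed.

Lemma int_eval_rmorph (S T : comNzRingType) (f : {rmorphism S -> T}) (y : S) p :
  f (int_eval y p) = int_eval (f y) p.
Proof.
rewrite /= /horner_eval -horner_map /= -map_poly_comp; congr _.[_].
by apply: eq_map_poly => z /=; rewrite rmorph_int.
Qed.

Lemma int_eval_comp (S : comNzRingType) (p : {poly int}) (q : {poly S}) :
  int_eval q p = map_poly (intr : int -> S) p \Po q.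
Proof.
rewrite /comp_poly -map_poly_comp; congr _.[_].
by apply: eq_map_poly => z /=; rewrite rmorph_int.
Qed.

End IntegerPolynomialEvaluation.

Section MarkovChainFunction.
Variables (n : nat).
Implicit Types G : digraph n.

Definition outdeg G (v : 'I_n) : nat := (\sum_j G v j)%N.

Lemma outdegmx_diag (F : comNzRingType) G (y : F) :
  y%:M + outdegmx F G = diag_mx (\row_v (y + (outdeg G v)%:R)).
Proof. by apply/matrixP => i j; rewrite !mxE -mulrnDl. Qed.

(** With M = (a + b)I + D, multiplication by det M turns xI + M^(-1)(A + aI) into xM + A + aI, which
    is (x(a + b) + a)I + xD + A. *)
Lemma mu_at_eta (F : fieldType) G (a b : F) :
  (forall v, a + b + (outdeg G v)%:R != 0) ->
  (eta_at G (a + b) 1 0)%:P * mu_at G a b =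
  eta_at G ('X * (a + b)%:P + a%:P) 'X 1.
Proof.
move=> nz; set M := (a + b)%:M + outdegmx F G.
have -> : eta_at G (a + b) 1 0 = \det M by rewrite /eta_at scale1r scale0r addr0.
have uM : M \in unitmx.
  rewrite unitmxE /M outdegmx_diag det_diag unitfE; apply/prodf_neq0 => v _.
  by rewrite mxE.
rewrite -det_map_mx -det_mulmx mulmxDr mul_mx_scalar -map_mxM mulmxA mulmxV // mul1mx.
congr determinant; apply/matrixP => i j; rewrite !mxE.
by case: (i == j); rewrite ?mulr1n ?mulr0n !rmorphD ?rmorph0 !rmorph_nat /= ?rmorphD; ring.
Qed.

Lemma mu_eq_of_eta (F : fieldType) G G' (a b : F) :
  (forall v, a + b + (outdeg G v)%:R != 0) ->
  (forall v, a + b + (outdeg G' v)%:R != 0) ->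
  eta G = eta G' -> mu_at G a b = mu_at G' a b.
Proof.
move=> nz nz' E; have := mu_at_eta nz'; rewrite -!(eta_eq_at _ _ _ E) -mu_at_eta //.
move/mulfI => -> //; rewrite polyC_eq0 /eta_at scale1r scale0r addr0 outdegmx_diag det_diag.
by apply/prodf_neq0 => v _; rewrite mxE.
Qed.

(** This coefficient is the trace of M^(-1)(A + aI), where M^(-1) is diagonal and, without loops,
    the diagonal of A + aI is constantly a. *)
Lemma mu_at_trace (F : fieldType) G (a b : F) : (forall v, G v v = 0%N) ->
  (forall v, a + b + (outdeg G v)%:R != 0) ->
  (0 < n)%N -> (mu_at G a b)`_n.-1 = a * \sum_v (a + b + (outdeg G v)%:R)^-1.
Proof.
move=> loopless nz n0; set M := (a + b)%:M + outdegmx F G.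
pose V := diag_mx (\row_v (a + b + (outdeg G v)%:R)^-1).
have MV : M *m V = 1%:M.
  rewrite /M outdegmx_diag mulmx_diag; apply/matrixP => i j; rewrite !mxE.
  by rewrite divff.
have uM : M \in unitmx by case/mulmx1_unit: MV.
have iM : invmx M = V by rewrite -[RHS]mul1mx -(mulVmx uM) -mulmxA MV mulmx1.
have -> : mu_at G a b = char_poly (- (invmx M *m (adjmx F G + a%:M))).
  by rewrite /char_poly /char_poly_mx map_mxN opprK.
rewrite char_poly_trace // raddfN opprK iM mulr_sumr; apply: eq_bigr => v _.
rewrite mul_diag_mx !mxE loopless eqxx add0r mulr1n mulrC.
by [].
Qed.

Lemma log_deriv_prod_XaddN (K : fieldType) (f : {rmorphism {poly int} -> K})
    (I : nat) (d : 'I_I -> nat) (y : K) :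
  f 'X = y -> (forall v, y + (d v)%:R != 0) ->
  f (\prod_v ('X + (d v)%:R))^`() =
  f (\prod_v ('X + (d v)%:R)) * \sum_v (y + (d v)%:R)^-1.
Proof.
move=> fX nz; rewrite deriv_prod_ord rmorph_sum mulr_sumr; apply: eq_bigr => v _.
rewrite 2!rmorph_prod (bigD1 v) //= [in RHS](bigD1 v) //= eqxx.
have -> : ('X + (d v)%:R : {poly int})^`() = 1.
  by rewrite derivD derivX -polyC_natr derivC addr0.
rewrite rmorph1 mul1r rmorphD fX rmorph_nat mulrC mulrA mulVf // mul1r.
by apply: eq_bigr => w /negPf ->.
Qed.

(** * Markov chain functions over C(a, b) and C(a) at once *)

Section Specialize.
Variables (D : idomainType) (C : numFieldType) (phi : {rmorphism D -> {poly C}}).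
Variables (a b : D) (c : C).
Hypotheses (phia : phi a = 'X) (phib : phi b = c%:P).

Let K := {fraction D}.
Let a' : K := FracField.tofrac a.
Let b' : K := FracField.tofrac b.

(** [phi] will be the identity for C(a) and the substitution b = 0 for C(a, b). It sends a + b + d
    to X + c + d, which is not zero. *)
Lemma markov_denom_neq0 (d : nat) : a' + b' + d%:R != 0.
Proof.
rewrite /a' /b' -rmorphD -(rmorph_nat (@FracField.tofrac D)) -rmorphD tofrac_eq0.
apply: contra_neq (@oner_neq0 C) => /(congr1 phi).
rewrite !rmorphD phia phib rmorph_nat rmorph0 => /(congr1 (fun p : {poly C} => p`_1)).
by rewrite !coefD coefX coefC coefMn coef1 coef0 mul0rn !addr0.
Qed.

Lemma mu_at_tofrac_eq G G' : eta G = eta G' -> mu_at G a' b' = mu_at G' a' b'.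
Proof. by apply: mu_eq_of_eta => v; apply: markov_denom_neq0. Qed.

(* The coefficient of x^(n-1) is a times the logarithmic derivative at a + b of
   the product of the Y + d_v. *)
Lemma mu_at_degrees G G' : (forall v, G v v = 0%N) -> (forall v, G' v v = 0%N) ->
  mu_at G a' b' = mu_at G' a' b' ->
  eta_at G (a' + b') 1 0 = eta_at G' (a' + b') 1 0.
Proof.
move=> l l' E.
have [n0|n0] := posnP n; first by rewrite /eta_at; case: n0 G G' {l l' E} => -> G G';
  rewrite !det_mx00.
pose P (H : digraph n) := \prod_v ('X + (outdeg H v)%:R) : {poly int}.
have mP H : P H \is monic.
  by apply: monic_prod => v _; rewrite -polyC_natr monicXaddC.
have sP H : size (P H) = n.+1.
  rewrite /P (eq_bigr (fun v => 'X - (- (outdeg H v)%:R)%:P)); last first.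
    by move=> v _; rewrite rmorphN opprK rmorph_nat.
  by rewrite -big_enum size_prod_XsubC size_enum_ord.
have evP H : int_eval (a' + b') (P H) = eta_at H (a' + b') 1 0.
  rewrite rmorph_prod /eta_at scale1r scale0r addr0 outdegmx_diag det_diag.
  by apply: eq_bigr => v _; rewrite mxE rmorphD int_evalX rmorph_nat.
have evP' H : int_eval (a' + b') (P H)^`() =
    int_eval (a' + b') (P H) * \sum_v (a' + b' + (outdeg H v)%:R)^-1.
  exact: (log_deriv_prod_XaddN (int_evalX _) (fun v => markov_denom_neq0 (outdeg H v))).
have a0 : a' != 0.
  rewrite tofrac_eq0; apply: contra_neq (@oner_neq0 C) => /(congr1 phi).
  by rewrite phia rmorph0 => /(congr1 (fun p : {poly C} => p`_1)); rewrite coefX coef0.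
have sumE : \sum_v (a' + b' + (outdeg G v)%:R)^-1 = \sum_v (a' + b' + (outdeg G' v)%:R)^-1.
  apply: (mulfI a0).
  rewrite -(mu_at_trace l (fun v => markov_denom_neq0 (outdeg G v)) n0).
  by rewrite -(mu_at_trace l' (fun v => markov_denom_neq0 (outdeg G' v)) n0) E.
(* Equal logarithmic derivatives, cleared of denominators, give an integer polynomial [q] vanishing
   at a + b; applying [phi] gives q(X + c) = 0, so q = 0. *)
have PP : P G = P G'.
  apply: (monic_log_deriv_eq (mP G) (mP G')); first by rewrite !sP.
  apply/eqP; rewrite -subr_eq0.
  set q := _ - _; have q0 : int_eval (a' + b') q = 0.
    rewrite /q rmorphB !rmorphM !evP' sumE.
    move: (int_eval _ (P G)) (int_eval _ (P G')) (\sum_v _) => y z w.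
    by rewrite mulrAC [z * w * y]mulrAC [z * y]mulrC subrr.
  move: q q0 => q q0; have {}q0 : int_eval (a + b) q = 0.
    apply/eqP; rewrite -(tofrac_eq0 (int_eval (a + b) q)) int_eval_rmorph rmorphD.
    apply/eqP; exact q0.
  have qX : map_poly (intr : int -> C) q \Po ('X + c%:P) = 0.
    by rewrite -int_eval_comp -phia -phib -rmorphD -int_eval_rmorph q0 rmorph0.
  have s2 : (1 < size ('X + c%:P : {poly C})%R)%N by rewrite size_XaddC.
  have q1 : map_poly (intr : int -> C) q = 0 by apply/eqP; rewrite -(comp_poly_eq0 _ s2) qX.
  by apply/eqP/(map_inj_poly (@intr_inj C) (rmorph0 _)); rewrite q1 map_poly0.
by rewrite -!evP PP.
Qed.

(** Once the factors det((a + b)I + D) agree, they can be replaced by each other. Setting x = k and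
    applying [phi] leaves the substitution of (k + 1)X + kc for X, which is injective on
    polynomials. *)
Lemma eta_of_mu_at_tofrac G G' : (forall v, G v v = 0%N) -> (forall v, G' v v = 0%N) ->
  mu_at G a' b' = mu_at G' a' b' -> eta G = eta G'.
Proof.
move=> l l' E; have Edeg := mu_at_degrees l l' E.
have := mu_at_eta (fun v => markov_denom_neq0 (outdeg G' v)).
rewrite -E -Edeg mu_at_eta => [{Edeg E}E|v]; last exact: markov_denom_neq0.
apply: (@eta_eq_of_nat _ C) => k k2.
have {}E : eta_at G (k%:R * (a + b) + a) k%:R 1 = eta_at G' (k%:R * (a + b) + a) k%:R 1.
  apply/eqP; rewrite -tofrac_eq; apply/eqP; move/(congr1 (horner_eval k%:R)): E.
  rewrite !eta_at_rmorph !rmorphD !rmorphM !rmorph1 !rmorphD /= /horner_eval !hornerC hornerX.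
  by rewrite rmorph_nat => ->.
have mE H : phi (eta_at H (k%:R * (a + b) + a) k%:R 1) =
    eta_at H 'X k%:R 1 \Po (k.+1%:R *: 'X + (k%:R * c)%:P).
  rewrite !eta_at_rmorph !rmorph1 !rmorphD rmorphM !rmorph_nat rmorphD phia phib /= comp_polyX.
  congr eta_at; rewrite scaler_nat polyCM polyC_natr mulrDr mulr_natl mulrSr.
  by rewrite addrAC.
have := congr1 phi E; rewrite !mE => /eqP; rewrite -subr_eq0 -rmorphB comp_poly_eq0.
  by rewrite subr_eq0 => /eqP.
rewrite size_polyDl size_scale ?size_polyX ?pnatr_eq0 //.
by rewrite (leq_ltn_trans (size_polyC_leq1 _)).
Qed.

End Specialize.
End MarkovChainFunction.

(** * Newton's identities *)

(** Jacobi's formula: differentiate one row at a time and expand along that row to obtain the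
    cofactors. *)
Lemma deriv_det (R : comNzRingType) n (M : 'M[{poly R}]_n) :
  (\det M)^`() = \tr (map_mx (@deriv R) M *m \adj M).
Proof.
pose Mi i := \matrix_(k, j) (if k == i then (M k j)^`() else M k j).
transitivity (\sum_i \det (Mi i)).
  rewrite /determinant raddf_sum exchange_big; apply: eq_bigr => s _ /=.
  have dsign (p : {poly R}) : ((-1) ^+ s * p)^`() = (-1) ^+ s * p^`().
    by rewrite !mulr_sign; case: (s : bool); rewrite ?derivN.
  rewrite dsign -mulr_sumr.
  congr (_ * _); rewrite deriv_prod_ord; apply: eq_bigr => i _.
  by apply: eq_bigr => j _; rewrite mxE.
apply: eq_bigr => i _; rewrite (expand_det_row _ i) mxE; apply: eq_bigr => j _.
rewrite !mxE eqxx; congr (_ * _); rewrite /cofactor; congr (_ * \det _).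
by apply/matrixP => a b; rewrite !mxE eq_sym (negPf (neq_lift _ _)).
Qed.

Section Newton.
Variable R : comNzRingType.
Implicit Types (N : nat).

Definition rev_char N (W : 'M[R]_N) : {poly R} := \det (1%:M - 'X *: map_mx polyC W).

Lemma rev_char0 N (W : 'M[R]_N) : (rev_char W)`_0 = 1.
Proof.
rewrite -horner_coef0 -[_.[0]]/(horner_eval 0 _) -det_map_mx -[RHS](det1 R N).
congr determinant; apply/matrixP => i j.
by rewrite !mxE /= /horner_eval hornerD hornerN hornerM hornerX mul0r oppr0 addr0 hornerMn hornerC.
Qed.

(* Trace of adj(1 - XW) (1 - (XW)^(i+1)) W, with Jacobi's formula for the
   derivative of the determinant. *)
Lemma newton_traces N (W : 'M[R]_N) i :
  (rev_char W)`_i.+1 *+ i.+1 = - \sum_(j < i.+1) \tr (W ^+ j.+1) * (rev_char W)`_(i - j).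
Proof.
pose V := map_mx polyC W; pose x := 'X *: V; pose A := 1%:M - x.
have xX l : x ^+ l = 'X^l *: map_mx polyC (W ^+ l).
  elim: l => [|l IH]; first by rewrite !expr0 scale1r map_mx1.
  by rewrite !exprSr IH -!mulmxE map_mxM -scalemxAl -scalemxAr scalerA -exprSr.
have geom : \adj A *m (1%:M - x ^+ i.+1) = rev_char W *: \sum_(l < i.+1) x ^+ l.
  have -> : 1%:M - x ^+ i.+1 = A *m \sum_(l < i.+1) x ^+ l.
    by rewrite mulmxE -opprB subrX1 -mulNr opprB.
  by rewrite mulmxA mul_adj_mx mul_scalar_mx.
have dq : (rev_char W)^`() = - \tr (\adj A *m V).
  rewrite deriv_det mxtrace_mulC -[RHS](raddfN mxtrace) -mulmxN; congr (\tr (_ *m _)).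
  apply/matrixP => k l; rewrite !mxE derivB derivM derivX derivC mulr0 addr0 mul1r.
  rewrite [_^`()](_ : _ = 0) ?sub0r //.
  by case: (k == l); rewrite ?mulr1n ?mulr0n ?derivE.
have := congr1 (fun B => (\tr (B *m V))`_i) geom.
have -> : (\tr (\adj A *m (1%:M - x ^+ i.+1) *m V))`_i = - ((rev_char W)`_i.+1 *+ i.+1).
  rewrite mulmxBr mulmx1 mulmxBl raddfB /= coefB xX -scalemxAr -scalemxAl mxtraceZ.
  by rewrite coefXnM ltnSn subr0 -coef_deriv dq coefN opprK.
rewrite -scalemxAl mxtraceZ mulmx_suml raddf_sum coefMr => E.
rewrite -[LHS]opprK E; congr (- _); apply: eq_bigr => j _.
rewrite mulrC; congr (_ * _); rewrite coef_sum (bigD1 j) //= big1 => [|l /negPf lj];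
  rewrite xX -scalemxAl mxtraceZ -map_mxM trace_map_mx coefMC coefXn.
  by rewrite eqxx mul1r addr0 exprSr.
by rewrite eq_sym (_ : (_ == _) = false) ?mul0r.
Qed.

(** The constant term 1 isolates the last trace in each identity, so the induction needs no
    division. *)
Lemma traces_of_rev_char N N' (W : 'M[R]_N) (W' : 'M[R]_N') : rev_char W = rev_char W' ->
  forall l, \tr (W ^+ l.+1) = \tr (W' ^+ l.+1).
Proof.
move=> E; elim/ltn_ind => l IH.
have := newton_traces W l; rewrite E (newton_traces W' l) => /oppr_inj.
rewrite !big_ord_recr /= subnn -{2}E !rev_char0 !mulr1 (eq_bigr (fun j : 'I_l =>
  \tr (W ^+ j.+1) * (rev_char W')`_(l - j))); last by move=> j _; rewrite IH.
by move/addrI.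
Qed.

End Newton.

(** Each identity determines only l + 1 times the next coefficient, hence the assumption on the
    characteristic. *)
Lemma rev_char_of_traces (R : idomainType) N N' (W : 'M[R]_N) (W' : 'M[R]_N') :
  (forall k : nat, k.+1%:R != 0 :> R) ->
  (forall l, \tr (W ^+ l.+1) = \tr (W' ^+ l.+1)) -> rev_char W = rev_char W'.
Proof.
move=> char0 E; apply/polyP; elim/ltn_ind => -[_|l IH]; first by rewrite !rev_char0.
apply: (mulIf (char0 l)); rewrite !mulr_natr !newton_traces; congr (- _).
by apply: eq_bigr => j _; rewrite E IH // ltnS leq_subr.
Qed.

(** * Bartholdi's determinant formula *)

Section Bartholdi.
Variables (n : nat).
Implicit Types G : digraph n.
Local Notation dart := ('I_n * 'I_n)%type.

Definition rev_dart (e : dart) : dart := (e.2, e.1).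

(* Equal to t if f is the reverse of e, and to 1 if f starts at the head of e
   otherwise. All pairs count as darts; rows of non-edges vanish. *)
Definition dart_weight (R : comNzRingType) G (t : R) (e f : dart) : R :=
  (G e.1 e.2)%:R * ((e.2 == f.1)%:R - (1 - t) * (f == rev_dart e)%:R).

Definition rev_entry (R : comNzRingType) G (e f : dart) : R :=
  (G e.1 e.2)%:R * (f == rev_dart e)%:R.

Lemma big_delta (R : comNzRingType) (T : finType) (F : T -> R) x :
  \sum_y F y * (y == x)%:R = F x.
Proof.
rewrite (bigD1 x) //= eqxx mulr1 big1 ?addr0 // => y /negPf ->; exact: mulr0.
Qed.

Lemma big_delta_l (R : comNzRingType) (T : finType) (F : T -> R) x :
  \sum_y (x == y)%:R * F y = F x.
Proof. by rewrite -[RHS](big_delta F); apply: eq_bigr => y _; rewrite mulrC eq_sym. Qed.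

Lemma simple_graph_natr_sq (R : comNzRingType) G i j : is_simple_graph G ->
  (G i j)%:R * (G j i)%:R = (G i j)%:R :> R.
Proof.
move=> hG; rewrite (simple_graph_sym hG j i) (simple_graphE hG).
by case: (0 < _)%N; rewrite ?mulr1 ?mulr0.
Qed.

(** Both sides equal y^n det M for a block matrix [M] on darts and vertices. Multiplying by [P]
    clears the vertex-to-dart block and leaves the weighted edge matrix; multiplying by [Q], of
    determinant y^n, clears the dart-to-vertex block and leaves the reversal matrix and [eta_at]. *)
Lemma bartholdi (R : comNzRingType) G (t u : R) : is_simple_graph G ->
  let w := 1 - t in let y := 1 - u ^+ 2 * w ^+ 2 in
  fdet (fun e f : dart => (e == f)%:R - u * dart_weight G t e f) * y ^+ n =
  fdet (fun e f : dart => (e == f)%:R + u * w * rev_entry R G e f) *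
  eta_at G y (u ^+ 2 * w) (- u).
Proof.
move=> hG w y.
pose M (a b : dart + 'I_n) : R := match a, b with
  | inl e, inl f => (e == f)%:R + u * w * rev_entry R G e f
  | inl e, inr v => u * (G e.1 e.2)%:R * (e.2 == v)%:R
  | inr v, inl f => (v == f.1)%:R
  | inr v, inr v' => (v == v')%:R end.
pose P (a b : dart + 'I_n) : R := match a, b with
  | inl e, inl f => (e == f)%:R
  | inl e, inr v => 0
  | inr v, inl f => - (v == f.1)%:R
  | inr v, inr v' => (v == v')%:R end.
(* With J the reversal matrix, J^2 = 1 on edges, so 1 - uwJ is y times the inverse of 1 + uwJ. [Z]
   is its product with the incidence of edges and heads. *)
pose Z (e : dart) v : R := (G e.1 e.2)%:R * ((e.2 == v)%:R - u * w * (e.1 == v)%:R).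
pose Q (a b : dart + 'I_n) : R := match a, b with
  | inl e, inl f => (e == f)%:R
  | inl e, inr v => - u * Z e v
  | inr v, inl f => 0
  | inr v, inr v' => y * (v == v')%:R end.
have fdet1 (T : finType) : fdet (fun e f : T => (e == f)%:R) = 1 :> R.
  by rewrite fdet_scalar expr1n.
have detP : fdet P = 1 by rewrite fdet_lower //= !fdet1 mulr1.
have detQ : fdet Q = y ^+ n.
  rewrite fdet_upper //= fdet1 mul1r -[X in y ^+ X](card_ord n) -fdet_scalar.
  by apply: eq_fdet => v v'; rewrite mulr_natr.
have -> : fdet (fun e f : dart => (e == f)%:R - u * dart_weight G t e f) = fdet M.
  transitivity (fdet M * fdet P); last by rewrite detP mulr1.
  rewrite fdetM [RHS]fdet_upper => [|v f]; last first.
    rewrite /= big_sumType /= (big_delta (fun e : dart => (v == e.1)%:R)).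
    by rewrite (big_delta_l (fun v => - (v == f.1)%:R)) subrr.
  rewrite [X in _ * X](_ : _ = 1) ?mulr1; last first.
    rewrite -(fdet1 'I_n); apply: eq_fdet => v v';
      rewrite /= big_sumType /= big1 ?add0r => [|e _].
      by rewrite (big_delta_l (fun v => (v == v')%:R)).
    by rewrite mulr0.
  apply: eq_fdet => e f; rewrite /= big_sumType /=.
  rewrite (big_delta (fun f => (e == f)%:R + u * w * rev_entry R G e f)).
  rewrite (eq_bigr (fun v => (e.2 == v)%:R * (- (u * (G e.1 e.2)%:R * (v == f.1)%:R)))) => [|v _];
    last by ring.
  by rewrite big_delta_l /rev_entry /dart_weight -/w; ring.
rewrite -detQ fdetM [LHS]fdet_lower => [|e v]; last first.
  rewrite /= big_sumType /=.
  rewrite (eq_bigr (fun f => (e == f)%:R * (- u * Z f v) +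
     u * w * (G e.1 e.2)%:R * (- u * Z f v) * (f == rev_dart e)%:R)) => [|f _];
    last by rewrite /rev_entry; ring.
  rewrite big_split /= big_delta_l (big_delta (fun f => u * w * (G e.1 e.2)%:R * (- u * Z f v))).
  rewrite (eq_bigr (fun v' => (e.2 == v')%:R * (u * (G e.1 e.2)%:R * (y * (v' == v)%:R)))) => [|v' _];
    last by ring.
  rewrite big_delta_l.
  have GG := simple_graph_natr_sq R e.1 e.2 hG.
  rewrite /Z /rev_dart /= /y.
  by ring: GG.
congr (_ * _).
  apply: eq_fdet => e f; rewrite /= big_sumType /= [X in _ + X]big1 ?addr0 => [|v _];
    last by rewrite mulr0.
  by rewrite (big_delta (fun f => (e == f)%:R + u * w * rev_entry R G e f)).
rewrite fdet_ord /eta_at; congr determinant; apply/matrixP => v v';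
  rewrite !mxE /= big_sumType /=.
rewrite (eq_bigr (fun v0 => (v == v0)%:R * (y * (v0 == v')%:R))) // big_delta_l.
rewrite -(pair_bigA _ (fun i j => (v == i)%:R * (- u * Z (i, j) v'))) /=.
under eq_bigr => i _ do rewrite -mulr_sumr.
rewrite (big_delta_l (fun i => \sum_j - u * Z (i, j) v')).
rewrite (eq_bigr (fun j => - u * (G v j)%:R * (j == v')%:R +
   u ^+ 2 * w * (v == v')%:R * (G v j)%:R)) => [|j _]; last by rewrite /Z /=; ring.
rewrite big_split /= (big_delta (fun j => - u * (G v j)%:R)) -mulr_sumr -natr_sum.
by rewrite mulr_natr -[_ *+ (v == v')]mulr_natr; ring.
Qed.

End Bartholdi.

(** * Circuits and primitive cycles *)

Section ClosedWalks.
Variables (R : comNzRingType) (T : finType) (w : T -> T -> R).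

Fixpoint walk_weight (x : T) (s : seq T) (y : T) : R :=
  if s is z :: s' then w x z * walk_weight z s' y else w x y.

Lemma sum_tuple_cons l (F : seq T -> R) :
  \sum_(c : l.+1.-tuple T) F c = \sum_x \sum_(s : l.-tuple T) F (x :: s).
Proof.
rewrite pair_bigA /= (reindex (fun p : T * l.-tuple T => [tuple of p.1 :: p.2])) //=.
exists (fun c : l.+1.-tuple T => (thead c, [tuple of behead c])).
  by move=> [x s] _ /=; congr (_, _); apply: val_inj.
by move=> c _; rewrite [c in RHS]tuple_eta.
Qed.

Lemma mxtrace_exp_walks l :
  \tr ((\matrix_(i, j < #|T|) w (enum_val i) (enum_val j)) ^+ l.+1) =
  \sum_(c : l.+1.-tuple T) walk_weight (thead c) (behead c) (thead c).
Proof.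
set W := \matrix_(i, j) _.
have WE x y : (W ^+ l.+1) (enum_rank x) (enum_rank y) =
    \sum_(s : l.-tuple T) walk_weight x s y.
  elim: l x => [|l IH] x.
    by rewrite expr1 mxE !enum_rankK (big_pred1 [tuple]) // => s; apply/esym/eqP;
      rewrite tuple0.
  rewrite exprS -mulmxE mxE (sum_tuple_cons _ (fun s => walk_weight x s y)).
  rewrite (reindex (enum_rank : T -> _)) /=; last first.
    by exists enum_val => i _; rewrite ?enum_rankK ?enum_valK.
  by apply: eq_bigr => z _; rewrite IH mxE !enum_rankK mulr_sumr.
pose F (s : seq T) : R := if s is x :: s' then walk_weight x s' x else 0.
rewrite (eq_bigr (fun c : l.+1.-tuple T => F c)); last by move=> c _; rewrite [c]tuple_eta.
rewrite (sum_tuple_cons _ F) /mxtrace (reindex (enum_rank : T -> _)) /=; last first.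
  by exists enum_val => i _; rewrite ?enum_rankK ?enum_valK.
by apply: eq_bigr => x _; rewrite WE.
Qed.

End ClosedWalks.

Section CircuitTraces.
Variables (n : nat) (G : digraph n).
Hypothesis hG : is_simple_graph G.
Local Notation dart := ('I_n * 'I_n)%type.

Definition circuit_poly (l : nat) : {poly int} :=
  \sum_(c : l.-tuple dart | is_circuit G c) 'X^(backtracks c).

Definition dart_matrix : 'M[{poly int}]_#|{: dart}| :=
  \matrix_(i, j) dart_weight G 'X (enum_val i) (enum_val j).

Lemma dart_weightE (e f : dart) : dart_weight G ('X : {poly int}) e f =
  if (0 < G e.1 e.2)%N && (e.2 == f.1) then 'X^(f == rev_dart e) else 0.
Proof.
rewrite /dart_weight [G _ _](simple_graphE hG); case: (0 < _)%N; last by rewrite mul0r.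
rewrite mul1r /=; have [ef|ef] := eqVneq e.2 f.1.
  by case: (f == rev_dart e); rewrite ?mulr1 ?mulr0 ?subr0 // opprB addrC subrK.
rewrite (_ : (f == rev_dart e) = false) ?mulr0 ?subr0 //.
by apply: contra_neqF ef => /eqP ->.
Qed.

Lemma walk_weight_dart (x y : dart) (s : seq dart) :
  walk_weight (dart_weight G ('X : {poly int})) x s y =
  if all (fun e => (0 < G e.1 e.2)%N) (x :: s) &&
     path (fun e f : dart => e.2 == f.1) x (rcons s y)
  then 'X^(count (fun p : dart * dart => p.2 == (p.1.2, p.1.1)) (zip (x :: s) (rcons s y)))
  else 0.
Proof.
elim: s x => [|z s IH] x; first by rewrite /= dart_weightE addn0 !andbT.
rewrite [LHS]/= IH dart_weightE /= exprD /rev_dart.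
case: (0 < G x.1 x.2)%N; case: (x.2 == z.1); rewrite ?mul0r ?andbF //=.
by case: ifP; rewrite ?mulr0.
Qed.

Lemma trace_dart_matrix l : \tr (dart_matrix ^+ l.+1) = circuit_poly l.+1.
Proof.
rewrite mxtrace_exp_walks /circuit_poly [RHS]big_mkcond; apply: eq_bigr => c _ /=.
rewrite walk_weight_dart; case: c => -[|x s] // sz /=.
by rewrite /is_circuit /backtracks /= rot1_cons.
Qed.

End CircuitTraces.

(** * Powers and periods of words *)

Section Words.
Variable T : eqType.
Implicit Types (c d s : seq T).

Definition wpow (k : nat) d := flatten (nseq k d).

Lemma wpowS k d : wpow k.+1 d = d ++ wpow k d. Proof. by []. Qed.

Lemma size_wpow k d : size (wpow k d) = (k * size d)%N.
Proof. by elim: k => // k IH; rewrite wpowS size_cat IH mulSn. Qed.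

Lemma rot_wpow i k d : (i <= size d)%N -> rot i (wpow k d) = wpow k (rot i d).
Proof.
move=> id; case: k => // k.
have E : take i d ++ wpow k (rot i d) = wpow k d ++ take i d.
  elim: k => [|k IH]; first by rewrite cats0.
  by rewrite !wpowS -catA -IH /rot !catA cat_take_drop.
rewrite !wpowS -{1}(cat_take_drop i d) -catA.
by rewrite -{1}(size_takel id) rot_size_cat -catA -E /rot !catA.
Qed.

Lemma wpow_of_commute k d s : d ++ s = s ++ d -> size s = (k * size d)%N -> s = wpow k d.
Proof.
elim: k s => [|k IH] s ds; first by rewrite mul0n => /size0nil.
rewrite mulSn => sz; have sd : take (size d) s = d.
  have := congr1 (take (size d)) ds; rewrite take_size_cat // takel_cat //.
  by rewrite sz leq_addr.
rewrite -(cat_take_drop (size d) s) sd wpowS; congr (_ ++ _).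
apply: IH; last by rewrite size_drop sz addKn.
move/eqP: ds; rewrite -{1 2}(cat_take_drop (size d) s) sd -!catA eqseq_cat // eqxx /=.
by move/eqP.
Qed.

(** Invariance under rotation by p says that the first p letters commute with the rest. *)
Lemma wpow_of_rot p k c : rot p c = c -> size c = (k.+1 * p)%N -> c = wpow k.+1 (take p c).
Proof.
move=> rc sz; have sp : size (take p c) = p by rewrite size_takel // sz mulSn leq_addr.
rewrite wpowS -{1}(cat_take_drop p c); congr (_ ++ _).
apply: wpow_of_commute; first by rewrite cat_take_drop -{1}rc.
by rewrite size_drop sz mulSn addKn sp.
Qed.

(** The range includes the full length, whose rotation fixes every word, so the search succeeds on
    nonempty words. *)
Definition min_period c := find (fun i => (0 < i)%N && (rot i c == c)) (iota 0 (size c).+1).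

Lemma min_periodP c : c != [::] ->
  [/\ (0 < min_period c <= size c)%N, rot (min_period c) c = c &
      forall i, (0 < i < min_period c)%N -> rot i c != c].
Proof.
move=> c0; have sc : (0 < size c)%N by rewrite lt0n size_eq0.
pose a i := (0 < i)%N && (rot i c == c).
have ha : has a (iota 0 (size c).+1).
  by apply/hasP; exists (size c); rewrite ?mem_iota //= /a sc rot_size eqxx.
have lt : (min_period c < (size c).+1)%N.
  by rewrite /min_period -[X in (_ < X)%N](size_iota 0) -has_find.
have := nth_find 0%N ha; rewrite nth_iota // add0n => /andP[p0 /eqP rp].
split=> //.
move=> i /andP[i0 ip]; have := before_find 0%N ip.
by rewrite nth_iota ?(ltn_trans ip) // add0n i0 => /negbT.
Qed.

Lemma rot_iter i c : (i <= size c)%N -> rot i c = iter i (rot 1) c.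
Proof.
elim: i => [|i IH] ic; first by rewrite rot0.
by rewrite rotS // IH // ltnW.
Qed.

(** Rotation by the length modulo the minimal period also fixes the word, so minimality makes this
    remainder 0. *)
Lemma min_period_dvd c : c != [::] -> (min_period c %| size c)%N.
Proof.
move=> c0; have [/andP[p0 pc] rp minp] := min_periodP c0;
  set p := min_period c in p0 pc rp minp *.
have itp q : iter (q * p) (rot 1) c = c.
  by elim: q => // q IH; rewrite mulSn iterD IH -rot_iter.
have rl : (size c %% p < p)%N by rewrite ltn_mod.
have [r0|r0] := posnP (size c %% p); first by rewrite /dvdn r0.
have := minp (size c %% p)%N; rewrite r0 rl => /(_ isT).
rewrite rot_iter ?(ltnW (leq_trans rl pc)) // -{2}(itp (size c %/ p)%N) -iterD addnC -divn_eq.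
by rewrite -rot_iter // rot_size eqxx.
Qed.

Lemma min_period_uniq p c : (0 < p <= size c)%N -> rot p c = c ->
  (forall i, (0 < i < p)%N -> rot i c != c) -> min_period c = p.
Proof.
move=> /andP[p0 pc] rp minp.
have c0 : c != [::] by rewrite -size_eq0 -lt0n (leq_trans p0).
have [/andP[q0 _] rq minq] := min_periodP c0.
apply/eqP; rewrite eqn_leq; apply/andP; split; rewrite leqNgt; apply/negP => lt.
  by have := minq p; rewrite p0 lt rp eqxx => /(_ isT).
by have := minp (min_period c); rewrite q0 lt rq eqxx => /(_ isT).
Qed.

Definition aperiodic d := [forall i : 'I_(size d), (0 < i)%N ==> (rot i d != d)].

Lemma aperiodicP d : reflect (forall i, (0 < i < size d)%N -> rot i d != d) (aperiodic d).
Proof.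
apply: (iffP forallP) => [H i /andP[i0 id]|H i]; first by have /implyP := H (Ordinal id); apply.
by apply/implyP => i0; apply: H; rewrite i0 ltn_ord.
Qed.

Lemma min_period_wpow k d : d != [::] ->
  (min_period (wpow k.+1 d) == size d) = aperiodic d.
Proof.
move=> d0; have sd : (0 < size d)%N by rewrite lt0n size_eq0.
have c0 : wpow k.+1 d != [::] by rewrite -size_eq0 size_wpow muln_eq0 /= size_eq0.
apply/eqP/aperiodicP => [E i /andP[i0 id]|ap].
  have [_ _ minp] := min_periodP c0; apply: contra_neq (minp i _).
    by move=> rd; rewrite rot_wpow ?(ltnW id) // rd.
  by rewrite E i0.
apply: min_period_uniq.
- by rewrite sd size_wpow mulSn leq_addr.
- by rewrite rot_wpow // rot_size.
move=> i /andP[i0 id]; rewrite rot_wpow ?(ltnW id) //; apply: contra (ap i _);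
  last by rewrite i0.
move/eqP/(congr1 (take (size d))).
by rewrite !wpowS !take_size_cat ?size_rot // => ->.
Qed.

Lemma zip_wpow k d d' : size d = size d' ->
  zip (wpow k d) (wpow k d') = flatten (nseq k (zip d d')).
Proof. by move=> sz; elim: k => // k IH; rewrite !wpowS zip_cat ?IH. Qed.

Lemma zip_rot i d d' : size d = size d' -> zip (rot i d) (rot i d') = rot i (zip d d').
Proof.
move=> sz; rewrite /rot zip_cat ?size_drop ?sz //.
have zdrop : forall i c c', zip (drop i c) (drop i c') = drop i (zip c c') :> seq (T * T).
  elim=> [|j IH] [|x c] [|y c'] //=; first by case: (drop _ _).
  by case: (drop j c).
have ztake : forall i c c', zip (take i c) (take i c') = take i (zip c c') :> seq (T * T).
  by elim=> [|j IH] [|x c] [|y c'] //=; rewrite ?IH //; case: (take _ _).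
by rewrite zdrop ztake.
Qed.

End Words.

(** * Circuits counted by length, period and backtracks *)

Section CircuitCounts.
Variables (n : nat) (G : digraph n).
Local Notation dart := ('I_n * 'I_n)%type.

Lemma cycle_zip (e : rel dart) (c : seq dart) : cycle e c = all (fun p => e p.1 p.2) (zip c (rot 1 c)).
Proof.
case: c => // x s; rewrite rot1_cons [LHS]/=.
by elim: s {1 3}x => [|z s IH] y /=; rewrite ?IH.
Qed.

Lemma is_circuit_rot i (c : seq dart) : is_circuit G (rot i c) = is_circuit G c.
Proof.
rewrite /is_circuit rot_cycle (perm_all _ (permEl (perm_rot i c))).
by rewrite -!size_eq0 size_rot.
Qed.

Lemma backtracks_rot i (c : seq dart) : backtracks (rot i c) = backtracks c.
Proof.
rewrite /backtracks rot_rot zip_rot ?size_rot //.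
exact: (seq.permP (permEl (perm_rot i _))).
Qed.

Lemma backtracks_wpow k (d : seq dart) : d != [::] -> backtracks (wpow k d) = (k * backtracks d)%N.
Proof.
move=> d0; have sd : (0 < size d)%N by rewrite lt0n size_eq0.
rewrite /backtracks rot_wpow // zip_wpow ?size_rot //.
by rewrite count_flatten map_nseq sumn_nseq mulnC.
Qed.

Lemma is_circuit_wpow k (d : seq dart) : is_circuit G (wpow k.+1 d) = is_circuit G d.
Proof.
have [->|d0] := eqVneq d [::]; first by rewrite [wpow _ _]size0nil ?size_wpow ?muln0.
have sd : (0 < size d)%N by rewrite lt0n size_eq0.
have all_pow (U : eqType) (a : pred U) s : all a (flatten (nseq k.+1 s)) = all a s.
  by elim: k => [|k' IH]; rewrite /= ?cats0 // all_cat -/(flatten (nseq k'.+1 s)) IH andbb.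
rewrite /is_circuit !cycle_zip rot_wpow // zip_wpow ?size_rot // !all_pow.
by rewrite -!size_eq0 size_wpow muln_eq0.
Qed.

(** A circuit with a smaller period is a proper power of an initial piece that is again a circuit;
    conversely, a rotated proper power is fixed by rotation through the length of its base. *)
Lemma is_primitive_aperiodic (c : seq dart) : is_circuit G c -> is_primitive G c <->
  aperiodic c.
Proof.
move=> circ; have c0 : c != [::] by case/and3P: circ.
split=> [prim|/aperiodicP ap i k d k2 circd E].
  have [/andP[p0 pc] rp _] := min_periodP c0; have := min_period_dvd c0.
  set p := min_period c in p0 pc rp *; move/dvdnP=> [q sc].
  case: q sc => [|[|q]] sc; first by rewrite mul0n in sc; move/size0nil: sc c0 => ->.
    have [_ _ minp] := min_periodP c0; apply/aperiodicP => i; rewrite sc mul1n; exact: minp.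
  have cE := wpow_of_rot rp sc.
  case: (prim 0%N q.+2 (take p c) isT); last by rewrite rot0.
  by rewrite -(is_circuit_wpow q.+1) -cE.
have d0 : d != [::] by case/and3P: circd.
have sd : (0 < size d)%N by rewrite lt0n size_eq0.
have sE : size c = (k * size d)%N by rewrite -(size_rot i) E -/(wpow k d) size_wpow.
have := ap (size d); rewrite sd sE ltn_Pmull // => /(_ isT)/eqP; apply.
by apply: (@rot_inj i); rewrite rot_rot E -/(wpow k d) rot_wpow // rot_size.
Qed.

Definition primitive_poly l : {poly int} :=
  \sum_(c : l.-tuple dart | is_circuit G c && aperiodic c) 'X^(backtracks c).

(** This polynomial carries all data of length l that enter [zeta_upto]. *)
Definition cycle_poly l : {poly int} :=
  \sum_(c in transversal (primitive_cycles G l) (primitive_circuits G l)) 'X^(backtracks c).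

(** These circuits are the (k + 1)-st powers of the primitive circuits of length p, and the power
    multiplies the number of backtracks by k + 1. *)
Lemma circuit_poly_period k p : (0 < p)%N ->
  \sum_(c : (k.+1 * p).-tuple dart | is_circuit G c && (min_period c == p)) 'X^(backtracks c) =
  primitive_poly p \Po 'X^(k.+1).
Proof.
move=> p0.
have szpow (d : p.-tuple dart) : size (wpow k.+1 d) == (k.+1 * p)%N by rewrite size_wpow size_tuple.
have sztake (c : (k.+1 * p).-tuple dart) : size (take p c) == p.
  by rewrite size_takel // size_tuple mulSn leq_addr.
rewrite (reindex_onto (fun d : p.-tuple dart => Tuple (szpow d)) (fun c => Tuple (sztake c)));
  last first.
  move=> c /andP[circ /eqP pE]; apply: val_inj => /=; apply/esym/wpow_of_rot;
    last by rewrite size_tuple.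
  by have [_ rp _] := min_periodP (let: And3 h _ _ := and3P circ in h); rewrite pE in rp.
rewrite /primitive_poly raddf_sum /=; apply: eq_big => [d|d /andP[/andP[circ _] _]].
  have -> : Tuple (sztake (Tuple (szpow d))) == d.
    by apply/eqP/val_inj; rewrite /= take_size_cat ?size_tuple.
  have d0 : val d != [::] by rewrite -size_eq0 size_tuple -lt0n.
  by rewrite andbT is_circuit_wpow -(min_period_wpow k d0) size_tuple.
rewrite backtracks_wpow; last by rewrite -size_eq0 size_tuple -lt0n.
by rewrite comp_Xn_poly exprM.
Qed.

Lemma circuit_polyE l : (0 < l)%N -> circuit_poly G l =
  \sum_(p < l.+1 | (p %| l)%N) (primitive_poly p \Po 'X^(l %/ p)).
Proof.
move=> l0; have c0 (c : l.-tuple dart) : val c != [::] by rewrite -size_eq0 size_tuple -lt0n.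
have mpl (c : l.-tuple dart) : (min_period c < l.+1)%N.
  by have [/andP[_]] := min_periodP (c0 c); rewrite size_tuple ltnS.
rewrite /circuit_poly (partition_big (fun c : l.-tuple dart => Ordinal (mpl c))
   (fun p : 'I_l.+1 => (p %| l)%N)) /=; last first.
  by move=> c _; have := min_period_dvd (c0 c); rewrite size_tuple.
apply: eq_bigr => p /dvdnP[q lE].
case: q lE => [|q] lE; first by rewrite lE in l0.
have p0 : (0 < p)%N by case: (posnP p) lE => // ->; rewrite muln0 => lE; rewrite lE in l0.
rewrite [X in (X %/ p)%N]lE mulnK // -circuit_poly_period //.
move: p lE p0 => [p pl] /= lE p0; move: mpl c0 pl; rewrite {}lE => mpl c0 pl.
by apply: eq_bigl => c; rewrite -(inj_eq val_inj).
Qed.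

(** The l rotations of a primitive circuit are distinct and have equally many backtracks. *)
Lemma primitive_polyE l : (0 < l)%N -> primitive_poly l = cycle_poly l *+ l.
Proof.
move=> l0; pose D := primitive_circuits G l.
have DE c : (c \in D) = is_circuit G c && aperiodic c.
  rewrite inE; case circ: (is_circuit G c) => //=.
  by apply/asboolP/idP => /(is_primitive_aperiodic circ).
have relP (c d : l.-tuple dart) : reflect (exists i, tval d = rot i c) (rotation_rel c d).
  apply: (iffP existsP) => [[i /eqP dE]|[i dE]]; first by exists i.
  (* Rotation by more than the length is the identity, so the bounded index in [rotation_rel] loses
     nothing. *)
  have il : (minn i l < l.+1)%N by rewrite ltnS geq_minr.
  by exists (Ordinal il); rewrite /= dE rot_minn size_tuple.
have eqv : {in D & &, equivalence_rel (@rotation_rel n l)}.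
  move=> c d e _ _ _; split; first by apply/relP; exists 0%N; rewrite rot0.
  move/relP => [i dE]; apply/relP/relP => -[j eE].
    exists (rot_add d (size d - i) j).
    by rewrite eE -rot_rot_add -[rot (size d - i) d]/(rotr i d) dE rotK.
  by exists (rot_add c i j); rewrite eE dE rot_rot_add.
have part : finset.partition (primitive_cycles G l) D := equivalence_partitionP eqv.
pose X := transversal (primitive_cycles G l) D.
have [_ triv _] := and3P part.
have tX : is_transversal X (primitive_cycles G l) D := transversalP part.
have sXD := transversal_sub tX.
rewrite /primitive_poly (eq_bigl (fun c => c \in D)); last by move=> c; rewrite DE.
rewrite -{1}(cover_partition part) big_trivIset //= -(pblock_transversal tX).
rewrite big_imset /=; last exact: (pblock_inj tX).
rewrite /cycle_poly -sumrMnl; apply: eq_bigr => c cX.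
have cD : c \in D by apply: (fintype.subsetP sXD).
have := cD; rewrite DE => /andP[circ /aperiodicP ap].
pose h (i : 'I_l) : l.-tuple dart := [tuple of rot i c].
have -> : finset.pblock (primitive_cycles G l) c = [set h i | i : 'I_l].
  apply/setP => d; apply/idP/imsetP => [dP|[i _ ->]].
    have dD : d \in D.
      by rewrite -(cover_partition part); apply/finset.bigcupP;
        exists (finset.pblock (primitive_cycles G l) c);
          rewrite ?pblock_mem // (cover_partition part).
    move: dP; rewrite (pblock_equivalence_partition eqv) // => /relP[i dE].
    have [il|il] := ltnP i l.
      by exists (Ordinal il) => //; apply: val_inj.
    by exists (Ordinal l0) => //; apply: val_inj; rewrite /= rot0 dE rot_oversize ?size_tuple.
  have hD : h i \in D.
    rewrite DE is_circuit_rot circ /=; apply/aperiodicP => j; rewrite size_rot => jl.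
    by rewrite /= rot_rot (inj_eq (@rot_inj i _)) ap.
  by rewrite (pblock_equivalence_partition eqv) //; apply/relP; exists i.
rewrite big_imset /=; last first.
  have inj (i j : 'I_l) : (i <= j)%N -> h i = h j -> i = j.
    move=> ij /(congr1 val) /= E; apply/val_inj/eqP; rewrite eqn_leq ij /= leqNgt;
      apply/negP => ltij.
    have := ap (j - i)%N;
      rewrite subn_gt0 ltij size_tuple (leq_ltn_trans (leq_subr _ _)) // => /(_ isT)/eqP.
    apply; apply: (@rot_inj i); rewrite rot_rot -rotD ?subnK ?size_tuple ?(ltnW (ltn_ord j)) //.
  move=> i j _ _ E; case: (leqP i j) => [|/ltnW] ij; first exact: inj.
  by apply/esym/inj.
by under eq_bigr => i _ do rewrite backtracks_rot; rewrite sumr_const card_ord.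
Qed.

End CircuitCounts.

(** * From cycle counts to eta and back *)

Section CyclesAndEta.
Variable n : nat.
Implicit Types G : digraph n.
Local Notation dart := ('I_n * 'I_n)%type.

Definition rev_matrix G : 'M[int]_#|{: dart}| :=
  \matrix_(i, j) rev_entry int G (enum_val i) (enum_val j).

Lemma rev_dartK : involutive (@rev_dart n). Proof. by case. Qed.

Lemma rev_matrix_sq G : is_simple_graph G ->
  rev_matrix G *m rev_matrix G =
  \matrix_(i, j) ((G (enum_val i).1 (enum_val i).2)%:R * (j == i)%:R).
Proof.
move=> hG; apply/matrixP => i j; rewrite !mxE.
under eq_bigr => k _ do rewrite !mxE.
rewrite -(big_enum_val (fun f => rev_entry int G (enum_val i) f * rev_entry int G f (enum_val j))) /=.
rewrite /rev_entry; under eq_bigr => f _ do rewrite -mulrA mulrCA mulrC.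
rewrite (big_delta (fun f : dart => _)) rev_dartK (inj_eq enum_val_inj) mulrA.
by rewrite simple_graph_natr_sq.
Qed.

Lemma rev_matrix_cube G : is_simple_graph G -> rev_matrix G ^+ 3 = rev_matrix G.
Proof.
move=> hG; rewrite exprSr expr2 -!mulmxE rev_matrix_sq //.
apply/matrixP => i j; rewrite !mxE.
rewrite (eq_bigr (fun k => ((G (enum_val i).1 (enum_val i).2)%:R * rev_matrix G k j) * (k == i)%:R)) => [|k _];
  last by rewrite mxE mulrAC.
rewrite (big_delta (fun k => _ * _)) mxE /rev_entry mulrA; congr (_ * _).
by rewrite (simple_graphE hG); case: (0 < _)%N; rewrite ?mulr1 ?mulr0.
Qed.

(** The reversal matrix equals its cube, so two powers suffice: the first has zero diagonal for lack
    of loops, the square is the diagonal indicator of edges. Odd l stands for the even exponent l +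
    1. *)
Lemma trace_rev_matrix G l : is_simple_graph G ->
  \tr (rev_matrix G ^+ l.+1) = if odd l then (\sum_i \sum_j G i j)%N%:R else 0.
Proof.
move=> hG; elim/ltn_ind: l => -[|[|l]] IH; last first.
  by rewrite -addn3 addnC exprD rev_matrix_cube // -exprS IH //= negbK.
  rewrite expr2 -mulmxE rev_matrix_sq // /mxtrace natr_sum /=.
  under eq_bigr => i _ do rewrite mxE eqxx mulr1.
  rewrite -(big_enum_val (fun e : dart => (G e.1 e.2)%:R)) /=.
  by rewrite -(pair_bigA _ (fun i j => (G i j)%:R)) /=; apply: eq_bigr => i _; rewrite natr_sum.
rewrite expr1 /mxtrace big1 // => i _; rewrite mxE /rev_entry.
case: eqP => [E|_]; last by rewrite mulr0.
have -> : (enum_val i).1 = (enum_val i).2 by rewrite {1}E.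
by case: hG => _ -> _; rewrite mul0r.
Qed.

Lemma rev_char_rev_matrix G G' : is_simple_graph G -> is_simple_graph G' ->
  (\sum_i \sum_j G i j = \sum_i \sum_j G' i j)%N ->
  rev_char (rev_matrix G) = rev_char (rev_matrix G').
Proof.
move=> hG hG' E; apply: rev_char_of_traces => [k|l]; first by rewrite pnatr_eq0.
by rewrite !trace_rev_matrix // E.
Qed.

Lemma fdet_rev_entry (R : comNzRingType) G (z : R) :
  fdet (fun e f : dart => (e == f)%:R + z * rev_entry R G e f) =
  int_eval (- z) (rev_char (rev_matrix G)).
Proof.
rewrite -det_map_mx; congr determinant; apply/matrixP => i j.
rewrite !mxE (inj_eq enum_val_inj) rmorphB rmorphM int_evalX mulNr opprK.
rewrite rmorph_nat; congr (_ + _ * _).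
rewrite [RHS](evalC intr) /rev_entry rmorphM !rmorph_nat.
by [].
Qed.

Lemma fdet_dart_weight G :
  fdet (fun e f : dart => (e == f)%:R - ('X : {poly {poly int}}) * dart_weight G 'X%:P e f) =
  rev_char (dart_matrix G).
Proof.
congr determinant; apply/matrixP => i j; rewrite !mxE (inj_eq enum_val_inj).
by rewrite /dart_weight rmorphM rmorphB rmorphM rmorphB !rmorph_nat rmorph1.
Qed.

(** A circuit of length 2 is an edge followed by its reverse, so cycle counts determine the number
    of edges. *)
Lemma circuit_poly_edges G : is_simple_graph G ->
  (circuit_poly G 2).[1] = (\sum_i \sum_j G i j)%N%:R.
Proof.
move=> hG; rewrite -trace_dart_matrix // -[_.[1]]/(horner_eval 1 _) raddf_sum natr_sum /=.
have dE (e f : dart) : (dart_weight G 'X e f).[1] = (G e.1 e.2)%:R * (e.2 == f.1)%:R :> int.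
  rewrite -[LHS]/(horner_eval 1 _) rmorphM rmorphB rmorphM rmorphB !rmorph_nat rmorph1.
  by rewrite /= /horner_eval hornerX subrr mul0r subr0.
under eq_bigr => i _.
  rewrite expr2 -mulmxE mxE /horner_eval horner_sum.
  under eq_bigr => k _ do rewrite hornerM !mxE !dE.
  rewrite -(big_enum_val (fun f : dart => (G (enum_val i).1 (enum_val i).2)%:R *
    ((enum_val i).2 == f.1)%:R * ((G f.1 f.2)%:R * (f.2 == (enum_val i).1)%:R))) /=.
  over.
rewrite /= -(big_enum_val (fun e : dart => \sum_(f : dart) ((G e.1 e.2)%:R *
    (e.2 == f.1)%:R * ((G f.1 f.2)%:R * (f.2 == e.1)%:R)))) /=.
rewrite -(pair_bigA _ (fun i j => \sum_(f : dart) ((G i j)%:R *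
    (j == f.1)%:R * ((G f.1 f.2)%:R * (f.2 == i)%:R)))) /=.
apply: eq_bigr => i _; rewrite natr_sum; apply: eq_bigr => j _.
rewrite (eq_bigr (fun f : dart => (G i j)%:R * (G f.1 f.2)%:R * (f == (j, i))%:R)) => [|f _].
  by rewrite (big_delta (fun f : dart => _)) simple_graph_natr_sq.
rewrite -pair_eqE /pair_eq /= [j == _]eq_sym; case: (f.1 == j); case: (f.2 == i);
  by rewrite ?mulr1 ?mulr0 ?mul0r.
Qed.

Let y : {poly {poly int}} := 1 - 'X ^+ 2 * (1 - 'X%:P) ^+ 2.

Lemma bartholdi_poly G : is_simple_graph G ->
  rev_char (dart_matrix G) * y ^+ n =
  int_eval (- ('X * (1 - 'X%:P))) (rev_char (rev_matrix G)) *
  eta_at G y ('X ^+ 2 * (1 - 'X%:P)) (- 'X).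
Proof.
by move=> hG; rewrite -fdet_rev_entry -fdet_dart_weight; apply: bartholdi.
Qed.

(* Specialize at u = 1/j, t = 1 + kj, where -1/u times the arguments of eta are
   j (k^2 - 1), k, 1. *)
Lemma eta_of_bartholdi_eta G G' :
  eta_at G y ('X ^+ 2 * (1 - 'X%:P)) (- 'X) = eta_at G' y ('X ^+ 2 * (1 - 'X%:P)) (- 'X) ->
  eta G = eta G'.
Proof.
move=> E; apply: (@eta_eq_of_nat _ rat) => k k2.
pose a : rat := k%:R ^+ 2 - 1.
have a0 : a != 0.
  by rewrite subr_eq0 -natrX (eqr_nat _ _ 1); case: k k2 {a} => [|[|k]].
have Ea : eta_at G (a *: 'X : {poly rat}) k%:R 1 = eta_at G' (a *: 'X) k%:R 1.
  apply: poly_eq_nat => [p q /eqP|j j2]; first by rewrite eqr_nat => /eqP.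
  have j0 : j%:R != 0 :> rat by rewrite pnatr_eq0; case: j j2.
  pose f1 : {rmorphism _ -> rat} := int_eval (1 + k%:R * j%:R : rat).
  pose f2 : {rmorphism _ -> rat} := horner_eval (j%:R^-1) \o map_poly f1.
  have f2X : f2 'X = j%:R^-1 by rewrite [LHS]evalX.
  have f2t : f2 'X%:P = 1 + k%:R * j%:R by rewrite [LHS]evalC int_evalX.
  have f2w : f2 (1 - 'X%:P) = 1 - (1 + k%:R * j%:R) by rewrite rmorphB rmorph1 f2t.
  have f2Xw : f2 ('X ^+ 2 * (1 - 'X%:P)) = j%:R^-1 ^+ 2 * (1 - (1 + k%:R * j%:R)).
    by rewrite rmorphM rmorphXn f2X f2w.
  have f2y : f2 y = 1 - j%:R^-1 ^+ 2 * (1 - (1 + k%:R * j%:R)) ^+ 2.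
    by rewrite rmorphB rmorph1 rmorphM !rmorphXn f2X f2w.
  have := congr1 f2 E; rewrite !eta_at_rmorph f2Xw f2y rmorphN f2X.
  move/(congr1 (fun z => (- j%:R) ^+ n * z)); rewrite -!eta_atM.
  rewrite -![_.[_]]/(horner_eval _ _) !eta_at_rmorph /= /horner_eval !hornerZ !hornerX.
  have -> : - j%:R * (1 - j%:R^-1 ^+ 2 * (1 - (1 + k%:R * j%:R)) ^+ 2) = a * j%:R :> rat.
    by rewrite /a; field.
  have -> : - j%:R * (j%:R^-1 ^+ 2 * (1 - (1 + k%:R * j%:R))) = k%:R :> rat by field.
  have -> : - j%:R * - j%:R^-1 = 1 :> rat by field.
  by rewrite -polyC_natr hornerC hornerC.
move: (congr1 (comp_poly (a^-1 *: 'X)) Ea); rewrite !eta_at_rmorph !rmorph_nat !rmorph1 /=.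
by rewrite comp_polyZ comp_polyX scalerA mulfV // scale1r.
Qed.

Lemma y_neq0 : y != 0.
Proof.
apply: contra_neq (@oner_neq0 {poly int}) => /(congr1 (horner_eval 0)).
by rewrite rmorph0 rmorphB rmorph1 rmorphM rmorphXn /= {1}/horner_eval hornerX expr0n mul0r subr0.
Qed.

Lemma rev_factor_neq0 G :
  int_eval (- ('X * (1 - 'X%:P)) : {poly {poly int}}) (rev_char (rev_matrix G)) != 0.
Proof.
apply: contra_neq (@oner_neq0 {poly int}) => /(congr1 (horner_eval 0)).
rewrite int_eval_rmorph [X in int_eval X](_ : _ = 0); last first.
  by rewrite rmorphN rmorphM /= {1}/horner_eval hornerX mul0r oppr0.
rewrite rmorph0 => <-.
by rewrite /= /horner_eval horner_coef0 coef_map rev_char0.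
Qed.

(** Circuit counts are divisor sums of primitive counts. The term p = l is the primitive count of
    length l itself, so strong induction inverts the relation. *)
Lemma cycle_circuit_poly G G' :
  (forall l, (0 < l)%N -> cycle_poly G l = cycle_poly G' l) <->
  (forall l, (0 < l)%N -> circuit_poly G l = circuit_poly G' l).
Proof.
split=> E.
  move=> l l0; rewrite !circuit_polyE //; apply: eq_bigr => p pl.
  have p0 : (0 < p)%N by case: (posnP p) pl l0 => // ->; rewrite dvd0n => /eqP ->.
  by rewrite !primitive_polyE // E.
suff P l : (0 < l)%N -> primitive_poly G l = primitive_poly G' l.
  move=> l l0; have := P l l0; rewrite !primitive_polyE //.
  rewrite -[cycle_poly G l *+ l]mulr_natr -[cycle_poly G' l *+ l]mulr_natr.
  by apply: mulIf; rewrite -polyC_natr polyC_eq0 pnatr_eq0 -lt0n.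
elim/ltn_ind: l => l IH l0; have := E l l0; rewrite !circuit_polyE //.
rewrite (bigD1 ord_max) ?dvdnn //= [in RHS](bigD1 ord_max) ?dvdnn //=.
rewrite divnn l0 expr1 !comp_polyXr.
rewrite (eq_bigr (fun p : 'I_l.+1 => primitive_poly G' p \Po 'X^(l %/ p))); first exact: addIr.
move=> p /andP[pl pm]; have p0 : (0 < p)%N by case: (posnP p) pl l0 => // ->;
  rewrite dvd0n => /eqP ->.
rewrite IH // ltn_neqAle -ltnS ltn_ord andbT.
by rewrite -(inj_eq val_inj) in pm.
Qed.

Lemma cycle_poly_of_eta G G' : is_simple_graph G -> is_simple_graph G' ->
  eta G = eta G' -> forall l, (0 < l)%N -> cycle_poly G l = cycle_poly G' l.
Proof.
move=> hG hG' E; apply/cycle_circuit_poly => -[//|l] _;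
  rewrite -(trace_dart_matrix hG) -(trace_dart_matrix hG').
apply: traces_of_rev_char; apply: (mulIf (expf_neq0 n y_neq0)).
rewrite [LHS](bartholdi_poly hG). rewrite [RHS](bartholdi_poly hG').
rewrite (rev_char_rev_matrix hG hG' (eta_edge_count E)).
congr (_ * _). exact: eta_eq_at.
Qed.

(** The number of edges is recovered first: it makes the reversal factors in Bartholdi's formula
    equal, so that they cancel. *)
Lemma eta_of_cycle_poly G G' : is_simple_graph G -> is_simple_graph G' ->
  (forall l, (0 < l)%N -> cycle_poly G l = cycle_poly G' l) -> eta G = eta G'.
Proof.
move=> hG hG' /cycle_circuit_poly E; apply: eta_of_bartholdi_eta.
have Ed : (\sum_i \sum_j G i j = \sum_i \sum_j G' i j)%N.
  by apply/eqP; rewrite -(eqr_nat int) -(circuit_poly_edges hG) -(circuit_poly_edges hG') E.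
have Eq : rev_char (dart_matrix G) = rev_char (dart_matrix G').
  apply: rev_char_of_traces => [k|l]; first by rewrite -polyC_natr polyC_eq0 pnatr_eq0.
  by rewrite (trace_dart_matrix hG) (trace_dart_matrix hG') E.
apply: (mulfI (rev_factor_neq0 G)); apply: etrans (esym (bartholdi_poly hG)) _.
apply: etrans (congr1 (fun q => q * y ^+ n) Eq) _; apply: etrans (bartholdi_poly hG') _.
exact: (congr1 (fun q => int_eval _ q * _) (esym (rev_char_rev_matrix hG hG' Ed))).
Qed.

End CyclesAndEta.

(** * The outgoing zeta function *)

Import numFieldNormedType.Exports.

(** The coefficients count how often each exponent occurs, so the exponents agree as multisets. *)
Lemma prod_of_sum_Xn (I J : finType) (A : {set I}) (B : {set J}) (f : I -> nat) (g : J -> nat) :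
  \sum_(i in A) 'X^(f i) = \sum_(j in B) 'X^(g j) :> {poly int} ->
  forall (C : comNzRingType) (F : nat -> C), \prod_(i in A) F (f i) = \prod_(j in B) F (g j).
Proof.
move=> E C F.
have cnt (K : finType) (D : {set K}) (h : K -> nat) m :
    (\sum_(k in D) 'X^(h k) : {poly int})`_m = (count_mem m [seq h k | k in D])%:R.
  rewrite coef_sum /image_mem -sum1_count big_map natr_sum big_enum_cond /=.
  rewrite [RHS]big_mkcond [LHS]big_mkcond; apply: eq_bigr => k _.
  by rewrite coefXn eq_sym; case: (k \in D); case: (h k == m).
have perm : perm_eq [seq f i | i in A] [seq g j | j in B].
  apply/allP => m _ /=; apply/eqP/eqP; rewrite -(eqr_nat int) -!cnt E.
  by [].
rewrite -[LHS]big_enum -[RHS]big_enum /=.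
rewrite -(big_map f xpredT F) -(big_map g xpredT F); exact: perm_big.
Qed.

Lemma zeta_upto_eq (C : numFieldType) n (G G' : digraph n) (t u : C) N :
  (forall l, (0 < l <= N)%N -> cycle_poly G l = cycle_poly G' l) ->
  zeta_upto G t u N = zeta_upto G' t u N.
Proof.
move=> E; apply: eq_big_nat => l; rewrite ltnS => lN.
exact: (prod_of_sum_Xn (E l _) (fun b => (1 - t ^+ b * u ^+ l)^-1)).
Qed.

Lemma zeta_eq_of_cycle_poly (C : numFieldType) n (G G' : digraph n) :
  (forall l, (0 < l)%N -> cycle_poly G l = cycle_poly G' l) -> zeta_eq C G G'.
Proof.
move=> E; exists 1 => // t u _ _; rewrite /zeta.
(* The partial products coincide as sequences, so their limits agree whether or not they
   converge. *)
have -> : zeta_upto G t u = zeta_upto G' t u; last by [].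
by apply: funext => N; apply: zeta_upto_eq => l /andP[l0 _]; apply: E.
Qed.

Section RealComplexLimit.
Variable R : realType.

Lemma cvg_real_complex (f : nat -> R) (l : R) :
  (f @ \oo --> l)%classic ->
    ((fun n => (f n)%:C%C : (R[i] : numFieldType)) @ \oo --> (l%:C%C : (R[i] : numFieldType)))%classic.
Proof.
move=> /cvgrPdist_lt fl; apply/cvgrPdist_lt => e e0.
have eE : e = (complex.Re e)%:C%C by rewrite RRe_real // gtr0_real.
have {}e0 : 0 < complex.Re e by rewrite -ltcR -eE.
apply: filterS (fl _ e0) => n; rewrite eE -rmorphB -ltcR.
by rewrite normc_def /= expr0n addr0 sqrtr_sqr.
Qed.

End RealComplexLimit.

(** * Estimates for the zeta product at real arguments *)

Section RealEstimates.
Variable R : realType.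

Lemma prod_one_sub_bounds (I : finType) (A : {set I}) (x : I -> R) :
  (forall i, 0 <= x i <= 1) ->
  let s := \sum_(i in A) x i in let p := \prod_(i in A) (1 - x i) in
  [/\ 0 <= s, 0 <= p <= 1, 1 - s <= p & p <= 1 - s + s ^+ 2].
Proof.
move=> x01; elim/big_rec2: _ => [|i s p _ [s0 /andP[p0 p1] sp ps]]; first by split; lra.
have /andP[x0 x1] := x01 i; split; first by lra.
- apply/andP; split; first by apply: mulr_ge0; lra.
  by apply: mulr_ile1; lra.
- nra.
- nra.
Qed.

Lemma nonpos_of_le_small (d K r : R) : 0 < r ->
  (forall u, 0 < u < r -> d <= K * u) -> d <= 0.
Proof.
move=> r0 H; rewrite leNgt; apply/negP => d0.
(* Chosen inside the allowed range and such that Ku is at most d/2. *)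
pose u := Num.min (r / 2) (d / (2 * (`|K| + 1))).
have K0 : 0 < `|K| + 1 by rewrite ltr_wpDl.
have K2 : 0 < 2 * (`|K| + 1) by rewrite mulr_gt0.
have u0 : 0 < u by rewrite lt_min !divr_gt0.
have ur : u < r by rewrite gt_min; apply/orP; left; lra.
have ud : u <= d / (2 * (`|K| + 1)) by rewrite ge_min lexx orbT.
have := H u; rewrite u0 ur => /(_ isT); rewrite ler_pdivlMr // in ud.
have := ler_norm K; move: `|K| K0 ud => k; nra.
Qed.

Variables (n : nat).
Implicit Types G : digraph n.
Let M : R := (n * n)%:R.

(** Reciprocals of the zeta factors are used: for t and u in [0, 1] they lie in [0, 1], so their
    products decrease. *)
Definition cycle_factor G (t u : R) l : R :=
  \prod_(c in transversal (primitive_cycles G l) (primitive_circuits G l))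
    (1 - t ^+ backtracks c * u ^+ l).

Definition cycle_value G (t : R) l : R := (map_poly (intr : int -> R) (cycle_poly G l)).[t].

Section Fixed.
Variables (t u : R).
Hypotheses (t0 : 0 <= t) (t1 : t <= 1) (u0 : 0 <= u) (u1 : u <= 1).
Let v := M * u.
Hypothesis v4 : v <= 4^-1.

Lemma v_ge0 : 0 <= v.
Proof. by rewrite mulr_ge0 // ler0n. Qed.

Lemma v_le1 : v <= 1.
Proof. by apply: le_trans v4 _; rewrite invf_le1 ?ler1n. Qed.

(** There are at most M^l tuples of l darts, whence the bound v^l with v = Mu. *)
Lemma cycle_factor_bounds G l :
  let s := cycle_value G t l * u ^+ l in
  [/\ 0 <= s, s <= v ^+ l, 0 <= cycle_factor G t u l <= 1,
      1 - s <= cycle_factor G t u l & cycle_factor G t u l <= 1 - s + s ^+ 2].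
Proof.
move=> s; pose T := transversal (primitive_cycles G l) (primitive_circuits G l).
have x01 (c : l.-tuple ('I_n * 'I_n)) : 0 <= t ^+ backtracks c * u ^+ l <= 1.
  by rewrite mulr_ge0 ?exprn_ge0 //= mulr_ile1 ?exprn_ge0 // exprn_ile1.
have sE : s = \sum_(c in T) t ^+ backtracks c * u ^+ l.
  rewrite /s /cycle_value /cycle_poly raddf_sum horner_sum mulr_suml.
  by apply: eq_bigr => c _; rewrite /= map_polyXn hornerXn.
have [] := prod_one_sub_bounds T x01; rewrite -sE -/(cycle_factor G t u l) => s0 p01 p1 p2.
split=> //; rewrite sE /v exprMn.
apply: (@le_trans _ _ (\sum_(c in T) u ^+ l)).
  by apply: ler_sum => c _; rewrite ler_piMl ?exprn_ge0 // exprn_ile1.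
rewrite sumr_const -mulr_natl ler_wpM2r ?exprn_ge0 // /M -natrX ler_nat.
by apply: leq_trans (max_card _) _; rewrite card_tuple card_prod card_ord.
Qed.

(** The term 2v^(a+m) is slack for the induction: the next factor costs at most v^(a+m), and as v is
    at most 1/4, the remaining v^(a+m) still covers 2v^(a+m+1). *)
Lemma cycle_tail_bounds G a m : (0 < a)%N ->
  1 - 2 * v ^+ a + 2 * v ^+ (a + m) <= \prod_(a <= l < a + m) cycle_factor G t u l <= 1.
Proof.
move=> a0; elim: m => [|m IH]; first by rewrite addn0 big_geq // subrK lexx.
have [_ sv /andP[f0 f1] sf _] := cycle_factor_bounds G (a + m).
rewrite addnS big_nat_recr ?leq_addr //=.
have vm : 0 <= v ^+ (a + m) by rewrite exprn_ge0 ?v_ge0.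
have v1 : v ^+ (a + m).+1 <= 4^-1 * v ^+ (a + m) by rewrite exprS ler_wpM2r.
have va1 : v ^+ a <= 4^-1.
  rewrite -(prednK a0) exprS -[4^-1]mulr1 ler_pM ?v_ge0 ?exprn_ge0 ?v_ge0 //.
  by rewrite exprn_ile1 ?v_ge0 ?v_le1.
move: (cycle_factor G t u (a + m)) (\prod_(_ <= l < _) _) (cycle_value G t (a + m) * _) sv f0 f1 sf IH.
move=> f P s sv f0 f1 sf /andP[P0 P1].
by apply/andP; split; nra.
Qed.

Lemma zeta_upto_real G N :
  zeta_upto G t%:C%C u%:C%C N = ((\prod_(1 <= l < N.+1) cycle_factor G t u l)^-1)%:C%C :> R[i].
Proof.
rewrite /zeta_upto -prodfV rmorph_prod; apply: eq_bigr => l _.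
rewrite /cycle_factor -prodfV rmorph_prod; apply: eq_bigr => c _.
by rewrite fmorphV rmorphB rmorph1 rmorphM !rmorphXn.
Qed.

(** The reciprocal products decrease and stay above 1/2, so their limit is nonzero and inversion
    passes to the limit. *)
Lemma zeta_real_limit G : exists2 L : R,
  ((fun N => \prod_(1 <= l < N.+1) cycle_factor G t u l) @ \oo --> L)%classic &
  zeta G (t%:C%C : R[i]) u%:C%C = (L^-1)%:C%C.
Proof.
pose h N := \prod_(1 <= l < N.+1) cycle_factor G t u l.
have hb N : 2^-1 <= h N.
  have /andP[+ _] := cycle_tail_bounds G N (ltn0Sn 0); apply: le_trans.
  have := exprn_ge0 (1 + N) v_ge0; rewrite expr1; move: (v ^+ _) v4 => w; lra.
have hc : cvgn h.
  apply: nonincreasing_is_cvgn.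
    apply/nonincreasing_seqP => N; rewrite /h [X in X <= _]big_nat_recr //=.
    have [_ _ /andP[f0 f1] _ _] := cycle_factor_bounds G N.+1.
    have h0 : 0 <= h N by apply: le_trans (hb N); rewrite invr_ge0 ler0n.
    exact: ler_piMr.
  by exists 2^-1 => _ [N _ <-].
have [L hL] : exists L : R, (h @ \oo --> L)%classic by exists (limn h).
have L0 : L != 0.
  have : 2^-1 <= L by apply: (cvgr_to_ge hL); apply: nearW.
  by apply: contraTneq => ->; lra.
exists L => //; rewrite /zeta; apply: cvg_lim => //.
have -> : zeta_upto G t%:C%C u%:C%C = (fun N => ((h N)^-1)%:C%C) :> (nat -> R[i]).
  by apply: funext => N; rewrite zeta_upto_real.
by apply: cvg_real_complex; apply: cvgV.
Qed.

(* Up to O(u^(a+1)), the factor of length a is 1 - u^a times the value at t of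
   the cycle polynomial; the longer cycles contribute only O(u^(a+1)). *)
Lemma zeta_compare G G' a : (0 < a)%N ->
  (forall l, (0 < l < a)%N -> cycle_poly G l = cycle_poly G' l) ->
  zeta G (t%:C%C : R[i]) u%:C%C = zeta G' (t%:C%C : R[i]) u%:C%C ->
  (cycle_value G' t a - cycle_value G t a) * u ^+ a <= 3 * v ^+ a.+1.
Proof.
move=> a0 Ecyc.
have [L hL ->] := zeta_real_limit G; have [L' hL' ->] := zeta_real_limit G'.
move=> /complexI /invr_inj LL'.
pose P H := \prod_(1 <= l < a) cycle_factor H t u l.
have PE : P G' = P G.
  apply: eq_big_nat => l /Ecyc /esym E.
  exact: (prod_of_sum_Xn E (fun b => 1 - t ^+ b * u ^+ l)).
have split_prod H m : \prod_(1 <= l < (a + m).+1) cycle_factor H t u l =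
    P H * (cycle_factor H t u a * \prod_(a.+1 <= l < a.+1 + m) cycle_factor H t u l).
  rewrite (@big_cat_nat _ _ _ a) ?leqW ?leq_addr //=; congr (_ * _).
  by rewrite big_ltn ?ltnS ?leq_addr // addSn.
have P0 : 0 < P G.
  have /andP[+ _] := cycle_tail_bounds G a.-1 (ltn0Sn 0); rewrite add1n prednK // -/(P G).
  apply: lt_le_trans; have := exprn_ge0 a v_ge0; rewrite expr1; move: (v ^+ a) v4 => w; lra.
have [s0 sv /andP[f0 f1] sf fs] := cycle_factor_bounds G a.
have [s0' sv' /andP[f0' f1'] sf' fs'] := cycle_factor_bounds G' a.
have low : P G * (cycle_factor G t u a * (1 - 2 * v ^+ a.+1)) <= L.
  apply: (cvgr_to_ge hL); exists a => // N /= aN; rewrite -(subnKC aN) split_prod.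
  have /andP[b _] := cycle_tail_bounds G (N - a) (ltn0Sn a).
  rewrite ler_pM2l // ler_wpM2l //; apply: le_trans b.
  by have := exprn_ge0 (a.+1 + (N - a)) v_ge0; lra.
have upp : L' <= P G * cycle_factor G' t u a.
  apply: (cvgr_to_le hL'); exists a => // N /= aN; rewrite -(subnKC aN) split_prod PE.
  have /andP[_ b] := cycle_tail_bounds G' (N - a) (ltn0Sn a).
  by rewrite ler_pM2l // ler_piMr.
have : cycle_factor G t u a * (1 - 2 * v ^+ a.+1) <= cycle_factor G' t u a.
  by rewrite -(ler_pM2l P0) (le_trans low) // LL'.
(* As a is positive, v^(2a) is at most v^(a+1). The constant 3 collects this error and 2v^(a+1) from
   the tail. *)
have s2 : (cycle_value G' t a * u ^+ a) ^+ 2 <= v ^+ a.+1.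
  apply: (@le_trans _ _ (v ^+ a * v ^+ a)).
    by rewrite expr2 ler_pM.
  rewrite exprSr ler_wpM2l ?exprn_ge0 ?v_ge0 // -(prednK a0) exprS ler_piMr ?v_ge0 //.
  by rewrite exprn_ile1 ?v_ge0 ?v_le1.
have va : 0 <= v ^+ a.+1 by rewrite exprn_ge0 ?v_ge0.
rewrite mulrBl.
move: (cycle_factor G t u a) (cycle_factor G' t u a) (cycle_value G t a * _) (cycle_value G' t a * _)
  (v ^+ a.+1) f0 f1 f0' f1' s0 s0' sf fs sf' fs' s2 va.
move=> f f' s s' w *; nra.
Qed.

End Fixed.

Lemma cycle_poly_of_zeta_eq G G' : zeta_eq R[i] G G' ->
  forall l, (0 < l)%N -> cycle_poly G l = cycle_poly G' l.
Proof.
move=> [r r0 E].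
have rE : r = (complex.Re r)%:C%C by rewrite RRe_real // gtr0_real.
have {}r0 : 0 < complex.Re r by rewrite -ltcR -rE.
pose rho := Num.min (complex.Re r) 1.
have rho0 : 0 < rho by rewrite lt_min r0 ltr01.
have rho1 : rho <= 1 by rewrite ge_min lexx orbT.
have Er t u : 0 <= t < rho -> 0 <= u < rho ->
    zeta G (t%:C%C : R[i]) u%:C%C = zeta G' (t%:C%C : R[i]) u%:C%C.
  have nE (x : R) : 0 <= x < rho -> `|x%:C%C : R[i]| < r.
    move=> /andP[x0]; rewrite lt_min => /andP[xr _].
    by rewrite rE normc_def /= expr0n addr0 sqrtr_sqr ger0_norm // ltcR.
  by move=> /nE ht /nE hu; apply: E.
elim/ltn_ind => a IH a0.
have Ecyc l : (0 < l < a)%N -> cycle_poly G l = cycle_poly G' l by case/andP => ? ?; apply: IH.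
have M0 : 0 <= M by rewrite ler0n.
(* Below this bound Mu is at most 1/4, as the estimates require. *)
pose rho' := Num.min rho (4 * (M + 1))^-1.
have rho'0 : 0 < rho' by rewrite lt_min rho0 invr_gt0; lra.
(* After division by u^a the upper bound is of order u, so letting u tend to 0 gives one inequality;
   exchanging the graphs gives the other. *)
have le_val (H H' : digraph n) t : 0 < t < rho ->
   (forall l, (0 < l < a)%N -> cycle_poly H l = cycle_poly H' l) ->
   (forall u, 0 <= u < rho -> zeta H (t%:C%C : R[i]) u%:C%C = zeta H' (t%:C%C : R[i]) u%:C%C) ->
   cycle_value H' t a <= cycle_value H t a.
  move=> /andP[t0 tr] Ec Ez; rewrite -subr_le0;
    apply: (@nonpos_of_le_small _ (3 * M ^+ a.+1) rho') => //.
  move=> u /andP[u0]; rewrite lt_min => /andP[ur uM].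
  have v4 : M * u <= 4^-1.
    have M1 : 0 < M + 1 by lra.
    rewrite invfM in uM; have : (M + 1) * u < (M + 1) * (4^-1 * (M + 1)^-1) by rewrite ltr_pM2l.
    by rewrite mulrCA mulfV ?gt_eqF // mulr1; lra.
  have ua : 0 < u ^+ a by rewrite exprn_gt0.
  have t1 := ltW (lt_le_trans tr rho1); have u1 := ltW (lt_le_trans ur rho1).
  have urho : 0 <= u < rho by rewrite (ltW u0) ur.
  rewrite -(ler_pM2r ua).
  apply: le_trans (zeta_compare (ltW t0) t1 (ltW u0) u1 v4 a0 Ec (Ez u urho)) _.
  by rewrite exprMn [u ^+ a.+1]exprS !mulrA.
have val t : 0 < t < rho -> cycle_value G t a = cycle_value G' t a.
  move=> tr; have tr' : 0 <= t < rho by case/andP: tr => /ltW -> ->.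
  apply/eqP; rewrite eq_le (le_val G' G t tr) ?(le_val G G' t tr) // => [u ur|l /Ecyc -> //|u ur];
    by rewrite Er.
apply: (map_inj_poly (@intr_inj R) (rmorph0 _)).
set p := map_poly _ _; set q := map_poly _ _.
apply/eqP; rewrite -subr_eq0; apply: contraT => nz.
(* These points lie between 0 and [rho], and there are more of them than a nonzero difference can
   have roots. *)
pose s := [seq rho / (k.+2)%:R | k <- iota 0 (size (p - q))].
have := @max_poly_roots _ (p - q) s nz; rewrite size_map size_iota ltnn.
rewrite [all _ _](_ : _ = true) ?map_inj_uniq ?iota_uniq //; first exact.
  by move=> x y /(mulfI (lt0r_neq0 rho0)) /invr_inj /eqP; rewrite eqr_nat => /eqP [].
apply/allP => _ /mapP [k _ ->]; rewrite /root hornerD hornerN subr_eq0; apply/eqP.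
apply: val; rewrite divr_gt0 //= ltr_pdivrMr // ltr_pMr // ltr1n.
by [].
Qed.

End RealEstimates.

(** * The equivalences *)

Section MarkovChainEquivalence.
Variables (C : numFieldType) (n : nat) (G G' : digraph n).
Hypotheses (hG : is_simple_graph G) (hG' : is_simple_graph G').

Lemma mu_eqP : mu C G = mu C G' <-> eta G = eta G'.
Proof.
pose phi : {rmorphism {poly {poly C}} -> {poly C}} := map_poly (horner_eval (0 : C)).
have phia : phi 'X = 'X by exact: map_polyX.
have phib : phi 'X%:P = 0%:P by rewrite [LHS]map_polyC /= /horner_eval hornerX.
split; last exact: (mu_at_tofrac_eq phia phib).
by apply: (eta_of_mu_at_tofrac phia phib); [case: hG | case: hG'].
Qed.

Lemma mu_spec_eqP (c : C) : mu_spec G c = mu_spec G' c <-> eta G = eta G'.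
Proof.
split; last exact: (@mu_at_tofrac_eq _ _ C idfun 'X c%:P c).
by apply: (@eta_of_mu_at_tofrac _ _ C idfun 'X c%:P c) => //; [case: hG | case: hG'].
Qed.

End MarkovChainEquivalence.

Theorem theorem5 (R : realType) (n : nat) (G G' : digraph n)
    (hG : is_simple_graph G) (hG' : is_simple_graph G') :
  [<->
    (* 1 *) zeta_eq R[i] G G';
    (* 2 *) mu R[i] G = mu R[i] G';
    (* 3 *) exists c : R[i], mu_spec G c = mu_spec G' c;
    (* 4 *) eta G = eta G';
    (* 5 *) forall (k : nat) (S : digraph k.+2), symmetric_invader S ->
              eta (invade S G) = eta (invade S G');
    (* 6 *) forall (k : nat) (S : digraph k.+2), symmetric_invader S ->
              chi (invade S G) = chi (invade S G');
    (* 7 *) forall k : nat,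
              chi (invade (path_invader k) G) = chi (invade (path_invader k) G');
    (* 8 *) forall k : nat, (0 < k)%N ->
              chi (invade (two_vertex_invader k 1) G) =
              chi (invade (two_vertex_invader k 1) G');
    (* 9 *) forall k : nat, (0 < k)%N ->
              chi (invade (two_vertex_invader 1 k) G) =
              chi (invade (two_vertex_invader 1 k) G')].
Proof.
(* The implications run in a cycle, each condition giving the next; apart from mere specialisations
   they pass through equality of [eta]. *)
tfae.
- by move=> /cycle_poly_of_zeta_eq /(eta_of_cycle_poly hG hG') /mu_eqP; apply.
- by move=> /mu_eqP E; exists 0; apply/mu_spec_eqP => //; apply: E.
- by move=> [c /mu_spec_eqP]; apply.
- by move=> E k S symS; apply: eta_invade_eq.
- by move=> E k S symS; rewrite !chi_eta_at; apply: eta_eq_at; apply: E.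
- by move=> E k; apply/E/symmetric_path.
- move=> /(eta_of_path hG hG') E k _; rewrite !chi_eta_at.
  by apply: eta_eq_at; apply: eta_invade_eq => //; apply: symmetric_two_vertex.
- move=> /(eta_of_two_vertex_loops hG hG') E k _; rewrite !chi_eta_at.
  by apply: eta_eq_at; apply: eta_invade_eq => //; apply: symmetric_two_vertex.
- move=> /(eta_of_two_vertex_edges hG hG') E; apply: zeta_eq_of_cycle_poly.
  exact: cycle_poly_of_eta.
Qed.
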